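(* For every graph $G$ and every direction $f$ of $G$ the following assertions are equivalent: (i) The direction $f$ is not countably determined in $G$. (ii) The graph $G$ contains either -- uncountably many disjoint pairwise inequivalent rays all of which start at vertices that dominate $\omega_f$, or -- uncountably many disjoint double rays, all having one tail in $\omega_f$ and another not in $\omega_f$, so that the latter tails are inequivalent for distinct double rays. Moreover, if (ii) holds, we can find the (double) rays in (ii) together with an uncountable star-decomposition of $G$ of finite adhesion such that $f$ lives in the central part and each (double) ray has a tail in its own leaf part (distinct (double) rays having distinct leaf parts).
   Context: Graphs may be infinite of any cardinality. Countable means finite or countably infinite. A ray is a one-way infinite path, a double ray is a two-way infinite path; tails are subrays. Two rays in $G$ are equivalent if no finite set of vertices of $G$ separates them; the equivalence classes of rays are the ends of $G$. A vertex $v$ dominates a ray $R\subseteq G$ if there is an infinite $v$--$R$ fan in $G$ (infinitely many $v$--$R$ paths pairwise meeting only in $v$); $v$ dominates an end if it dominates one (equivalently, each) of its rays. A direction of $G$ is a map $f$ that assigns to every finite set $X\subseteq V(G)$ a component $f(X)$ of $G-X$ such that $f(X)\supseteq f(X')$ whenever $X\subseteq X'$. Every end $\omega$ of $G$ defines a direction $f_\omega$, where $f_\omega(X)$ is the component of $G-X$ containing a tail of every ray in $\omega$; the map $\omega\mapsto f_\omega$ is a bijection between the ends and the directions of $G$. For a direction $f$, $\omega_f$ denotes the unique end $\omega$ with $f_\omega=f$. A directional choice in $G$ is a pair $(X,C)$ of a finite set $X\subseteq V(G)$ and a component $C$ of $G-X$. It distinguishes a direction $f$ from another direction $h$ if $f(X)=C$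 and $h(X)\neq C$. A direction $f$ is countably determined in $G$ if there is a countable set of directional choices in $G$ that distinguish $f$ from every other direction of $G$. A tree-decomposition of $G$ is a pair $(T,\mathcal V)$ of a tree $T$ and a family $\mathcal V=(V_t)_{t\in V(T)}$ of parts $V_t\subseteq V(G)$ such that $V(G)=\bigcup_t V_t$, every edge of $G$ has both endvertices in some $V_t$, and $V_{t_1}\cap V_{t_3}\subseteq V_{t_2}$ whenever $t_2$ lies on the path $t_1Tt_3$. Its adhesion sets are the sets $V_{t_1}\cap V_{t_2}$ for edges $t_1t_2$ of $T$; it has finite adhesion if all adhesion sets are finite. An uncountable star-decomposition is a tree-decomposition whose tree is a star $K_{1,\kappa}$ with $\kappa$ an uncountable cardinal; the part of the centre is the central part, the parts of the leaves are the leaf parts. If $(T,\mathcal V)$ has finite adhesion, an end $\omega$ of $G$ lives in a part $V_t$ if some (equivalently, every) ray in $\omega$ has infinitely many vertices in $V_t$; a direction $f$ lives in the part in which $\omega_f$ lives. *)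

(* Defs.v *)
From mathcomp Require Import all_boot all_order all_algebra finmap.
From mathcomp Require Import boolp classical_sets functions cardinality.

Set Implicit Arguments.
Unset Strict Implicit.
Unset Printing Implicit Defensive.

Local Open Scope classical_set_scope.

(* Simple graphs of arbitrary cardinality.  Classically, neither the choiceType
   structure nor the boolean adjacency is a restriction: {classic T} makes any
   type T a choiceType, and `[< P >] turns any proposition into a boolean. *)
Record sgraph := SGraph {
  vertex :> choiceType;
  adj : rel vertex;
  adj_sym : symmetric adj;
  adj_irrefl : irreflexive adj
}.

Section Graph.
Variable G : sgraph.

(* Finite walks and paths are written, as in mathcomp's path.v, by their first
   vertex x and the sequence s of the remaining vertices. *)
Definition connected_off (X : {fset G}) (x y : G) : Prop :=
  exists s : seq G, [/\ path (@adj G) x s, last x s = y &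
                        forall z, z \in x :: s -> z \notin X].

(* Components of G - X, given by their vertex sets. *)
Definition component (X : {fset G}) (C : set G) : Prop :=
  exists2 x : G, x \notin X & C = [set y | connected_off X x y].

Definition is_ray (r : nat -> G) : Prop :=
  injective r /\ forall n, adj (r n) (r n.+1).

Definition is_double_ray (d : int -> G) : Prop :=
  injective d /\ forall z, adj (d z) (d (z + 1)%R).

(* The tails of a double ray in either of its two directions. *)
Definition double_ray_tail (d : int -> G) (r : nat -> G) : Prop :=
  exists k : int, (forall n : nat, r n = d (k + n%:Z)%R) \/
                  (forall n : nat, r n = d (k - n%:Z)%R).

Definition separates (X : {fset G}) (A B : set G) : Prop :=
  forall a b, A a -> B b -> ~ connected_off X a b.

Definition ray_equiv (r r' : nat -> G) : Prop :=
  ~ exists X : {fset G}, separates X (range r) (range r').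

Definition is_end (w : set (nat -> G)) : Prop :=
  exists2 r, is_ray r & w = [set r' | is_ray r' /\ ray_equiv r r'].

(* v :: s is a v--R path, for R the vertex set of a ray.  It is allowed to start
   on R, so that a vertex of R can dominate R: it is then a v--(R - v) path, or
   trivial. *)
Definition fan_path (v : G) (R : set G) (s : seq G) : Prop :=
  [/\ path (@adj G) v s, uniq (v :: s), R (last v s) &
      forall z, z \in v :: s -> R z -> z = v \/ z = last v s].

Definition dominates (v : G) (r : nat -> G) : Prop :=
  exists F : set (seq G),
    [/\ infinite_set F, F `<=` fan_path v (range r) &
        forall s t, F s -> F t -> s <> t ->
          forall z, z \in v :: s -> z \in v :: t -> z = v].

Definition dominates_end (v : G) (w : set (nat -> G)) : Prop :=
  exists2 r, w r & dominates v r.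

Record direction := Direction {
  dir_map :> {fset G} -> set G;
  dir_component : forall X, component X (dir_map X);
  dir_mono : forall X X' : {fset G},
    fsubset X X' -> dir_map X' `<=` dir_map X
}.

(* f_w = f, where f_w X is the component of G - X containing a tail of every
   ray in w. *)
Definition defines_direction (w : set (nat -> G)) (f : direction) : Prop :=
  forall (X : {fset G}) r, w r -> exists n, forall m, (n <= m)%N -> f X (r m).

(* The unique end w with f_w = f; the default value set0 is not an end. *)
Definition end_of (f : direction) : set (nat -> G) :=
  xget set0 [set w | is_end w /\ defines_direction w f].

Definition directional_choice (c : {fset G} * set G) : Prop :=
  component c.1 c.2.

Definition distinguishes (c : {fset G} * set G) (f h : direction) : Prop :=
  f c.1 = c.2 /\ h c.1 <> c.2.

Definition countably_determined (f : direction) : Prop :=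
  exists S : set ({fset G} * set G),
    [/\ countable S, S `<=` directional_choice &
        forall h : direction, h <> f -> exists2 c, S c & distinguishes c f h].

Definition is_tree : Prop :=
  [/\ exists x : G, True,
      forall x y : G, exists2 s, path (@adj G) x s & last x s = y &
      forall c : seq G, ucycle (@adj G) c -> (size c <= 2)%N].

End Graph.

Definition tree_decomposition (G T : sgraph) (V : T -> set G) : Prop :=
  [/\ is_tree T,
      forall x : G, exists t, V t x,
      forall x y : G, adj x y -> exists t, V t x /\ V t y &
      forall (t1 : T) (s : seq T), path (@adj T) t1 s -> uniq (t1 :: s) ->
        forall t2, t2 \in t1 :: s -> V t1 `&` V (last t1 s) `<=` V t2].

Definition finite_adhesion (G T : sgraph) (V : T -> set G) : Prop :=
  forall t1 t2 : T, adj t1 t2 -> finite_set (V t1 `&` V t2).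

Definition lives_in (G : sgraph) (f : direction G) (P : set G) : Prop :=
  exists2 r, end_of f r & infinite_set (range r `&` P).

Section Star.
Variable I : choiceType.

Definition star_adj : rel (option I) := fun x y => isSome x != isSome y.

Fact star_adj_sym : symmetric star_adj.
Proof. by move=> x y; rewrite /star_adj eq_sym. Qed.

Fact star_adj_irrefl : irreflexive star_adj.
Proof. by move=> x; rewrite /star_adj eqxx. Qed.

(* K_{1,|I|}: the centre is None, the leaves are the vertices Some i. *)
Definition star : sgraph := SGraph star_adj_sym star_adj_irrefl.

End Star.

Definition uncountable_star_decomposition
    (G : sgraph) (I : choiceType) (V : star I -> set G) : Prop :=
  ~ countable [set: I] /\ tree_decomposition V.

(* Distinct elements of a disjoint family Rs or Ds below are distinct as
   subgraphs: rays have a unique parametrisation, and reparametrisations of a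
   double ray are not disjoint from it. *)
Definition dominating_rays
    (G : sgraph) (f : direction G) (Rs : set (nat -> G)) : Prop :=
  [/\ ~ countable Rs,
      Rs `<=` @is_ray G,
      trivIset Rs (fun r => range r),
      forall r r', Rs r -> Rs r' -> r <> r' -> ~ ray_equiv r r' &
      forall r, Rs r -> dominates_end (r 0%N) (end_of f)].

Definition splitting_double_rays
    (G : sgraph) (f : direction G) (Ds : set (int -> G)) : Prop :=
  [/\ ~ countable Ds,
      Ds `<=` @is_double_ray G,
      trivIset Ds (fun d => range d),
      forall d, Ds d ->
        (exists2 r, double_ray_tail d r & end_of f r) /\
        (exists2 r, double_ray_tail d r & ~ end_of f r) &
      forall d d' r r', Ds d -> Ds d' -> d <> d' ->
        double_ray_tail d r -> ~ end_of f r ->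
        double_ray_tail d' r' -> ~ end_of f r' -> ~ ray_equiv r r'].

Definition ray_has_tail_in (G : sgraph) (r : nat -> G) (P : set G) : Prop :=
  exists n, forall m, (n <= m)%N -> P (r m).

Definition double_ray_has_tail_in
    (G : sgraph) (d : int -> G) (P : set G) : Prop :=
  exists2 r, double_ray_tail d r & range r `<=` P.

(* Main.v *)
(* A direction f is countably determined iff some countable vertex set U has finite subsets
   telling f from every other direction.  If it is not, then a vertex a in f Z has a finite set
   meeting every separator of a from f that extends Z: infinitely many such separators, disjoint
   outside Z, would determine f.  Closing a countable U under these finite sets makes the trace
   on U of any finite separator separate as much of U as the separator itself.  Some direction
   h <> f agrees with f on the finite subsets of such a U, and by closedness it yields a ray in a
   component C of G - U that is not in the end of f.  The neighbourhood of C is either finite or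
   converges to f, so by the star-comb lemma C contains a vertex dominating f or a ray of the
   end of f, hence a new (double) ray disjoint from U.  So maximal families are uncountable.
   The star-decomposition comes from a maximal family of pairs (ray, finite set) whose components
   are pairwise disjoint and avoid the finite sets, extended past a closed U in the same way. *)
Require Import Defs.
From mathcomp Require Import all_boot all_order all_algebra finmap.
From mathcomp Require Import boolp classical_sets functions cardinality.
From mathcomp Require Import zify.
Local Open Scope classical_set_scope.

Set Implicit Arguments.
Unset Strict Implicit.
Unset Printing Implicit Defensive.

(** * Sets and countability *)

(** Zorn's lemma for pairwise related families. [R] need not be symmetric, so the maximality clause
    asks for it in both orders. *)
Lemma maximal_pairwise (T : Type) (P : set T) (R : T -> T -> Prop) :
  exists S : set T, [/\ S `<=` P,
    forall s t, S s -> S t -> s <> t -> R s t &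
    forall x, P x -> (forall s, S s -> s <> x -> R x s /\ R s x) -> S x].
Proof.
pose Q (S : set T) := S `<=` P /\ forall s t, S s -> S t -> s <> t -> R s t.
have [F FQ Ftot|S [[SP SR] Smax]] := @Zorn_bigcup T Q.
  split=> [x [X FX Xx]|s t [X FX Xs] [Y FY Yt] st]; first by have [+ _] := FQ X FX; apply.
  have [XY|YX] := Ftot X Y FX FY.
    by have [_] := FQ Y FY; apply=> //; exact: XY.
  by have [_] := FQ X FX; apply=> //; exact: YX.
exists S; split=> // x Px xR; apply: contrapT => NSx.
apply: (Smax (S `|` [set x])).
  by split=> [y Sy|SS]; [left|apply: NSx; apply: SS; right].
split=> [y [/SP //|->//]|s t [Ss|->] [St|->] //].
- exact: SR.
- by move=> sx; have [] := xR s Ss sx.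
- by move=> xt; have [] := xR t St (nesym xt).
Qed.

Lemma countable_enum (T : Type) (U : set T) (x0 : T) :
  countable U -> exists g : nat -> T, U `<=` range g.
Proof.
move=> /countable_injP[c cI].
have /choice[g gP] n : exists y, forall x, U x -> c x = n -> y = x.
  have [[x [Ux cx]]|H] := pselect (exists x, U x /\ c x = n).
    by exists x => y Uy cy; apply: cI; rewrite ?inE ?cx.
  by exists x0 => y Uy cy; case: H; exists y.
by exists g => x Ux; exists (c x) => //; apply: (gP (c x) x).
Qed.

(** Choosing a point of [U] in each member that meets [U] is injective because the members are
    disjoint. *)
Lemma card_le_hit (I T : Type) (D : set I) (F : I -> set T) (U : set T) :
  trivIset D F -> ([set i | D i /\ F i `&` U !=set0] #<= U)%card.
Proof.
move=> tF; have [[u0 Uu0]|/set0P/negP/negPn/eqP U0] := pselect (U !=set0); last first.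
  suff -> : [set i | D i /\ F i `&` U !=set0] = set0 by exact: card_ge0.
  by apply/seteqP; split=> // i [_ [x [_]]]; rewrite U0.
have /choice[g gP] i : exists u, D i /\ F i `&` U !=set0 -> (F i `&` U) u.
  have [[Di [x xP]]|H] := pselect (D i /\ F i `&` U !=set0).
    by exists x.
  by exists u0 => /H.
rewrite -(card_le_eql (inj_card_eq (f := g) _)).
  by apply: subset_card_le => _ [i /gP[_ ?] <-].
move=> i j /set_mem iP /set_mem jP gij.
apply: tF; [by case: iP|by case: jP|exists (g i)].
by split; [case: (gP i iP)|rewrite gij; case: (gP j jP)].
Qed.

Lemma finite_hit (I T : Type) (D : set I) (F : I -> set T) (U : set T) :
  trivIset D F -> finite_set U -> finite_set [set i | D i /\ F i `&` U !=set0].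
Proof. by move=> /card_le_hit-/(_ U); apply: card_le_finite. Qed.

Lemma infinite_avoid (I T : Type) (D : set I) (F : I -> set T) (U : set T) :
  trivIset D F -> infinite_set D -> finite_set U ->
  exists2 i, D i & F i `&` U = set0.
Proof.
move=> tF iD fU; apply: contrapT => H; apply: iD.
apply: sub_finite_set (finite_hit tF fU) => i Di; split=> //.
by apply: contrapT => /set0P/negP/negPn/eqP ?; apply: H; exists i.
Qed.

Lemma uncountable_avoid (I T : Type) (D : set I) (F : I -> set T) (U : set T) :
  trivIset D F -> ~ countable D -> countable U ->
  exists2 i, D i & F i `&` U = set0.
Proof.
move=> tF cD cU; apply: contrapT => H; apply: cD.
apply: sub_countable (card_le_trans _ (card_le_hit U tF)) cU.
apply: subset_card_le => i Di; split=> //.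
by apply: contrapT => /set0P/negP/negPn/eqP ?; apply: H; exists i.
Qed.

Lemma countable_setU (T : Type) (A B : set T) :
  countable A -> countable B -> countable (A `|` B).
Proof.
move=> cA cB; rewrite -bigcup2E; apply: bigcup_countable => //.
by move=> [|[|n]] _; rewrite /bigcup2 //=; exact: countable0.
Qed.

Lemma infinite_enum (T : Type) (A : set T) :
  infinite_set A -> exists2 g : nat -> T, injective g & range g `<=` A.
Proof.
move=> /infiniteP/card_leP[f].
exists (fun n => set_val (f (SigSub (mem_set (I : [set: nat] n))))).
  move=> i j /= /val_inj/(@inj _ _ _ f)/= H.
  by have /(congr1 val) := H (mem_set Logic.I) (mem_set Logic.I).
move=> _ [n _ <-]; case: (f _) => x xA /=; exact: set_mem.
Qed.

Lemma range_map (I : Type) (T : eqType) (g : I -> T) (s : seq T) :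
  (forall x, x \in s -> range g x) -> exists t, map g t = s.
Proof.
elim: s => [|x s IH] sg; first by exists [::].
have [|t <-] := IH; first by move=> z zs; apply: sg; rewrite inE zs orbT.
by have [i _ <-] := sg x (mem_head _ _); exists (i :: t).
Qed.

(** Each stage lists, for every finite sequence over the previous range, its entries and the values
    of [Phi] on it. A finite sequence over the union of the stages lies in one stage, so the next
    stage holds these values. *)
Lemma countable_closure (T : eqType) (Phi : seq T -> seq T) (U : set T) (x0 : T) :
  countable U -> exists g : nat -> T, U `<=` range g /\
    forall s, (forall x, x \in s -> range g x) -> forall y, y \in Phi s -> range g y.
Proof.
move=> /(countable_enum x0)[g0 g0U].
pose step (g : nat -> T) k :=
  if choice.unpickle k is Some (s, i) then nth x0 (map g s ++ Phi (map g s)) i else x0.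
have stepS g n : range (step g) (g n).
  by exists (choice.pickle ([:: n], 0%N)) => //; rewrite /step choice.pickleK.
pose G n := iter n step g0.
have Gmono n m : (n <= m)%N -> range (G n) `<=` range (G m).
  move=> /subnK <-; elim: (m - n)%N => [//|k IH] x /IH[i _ <-]; exact: stepS.
pose g k := if choice.unpickle k is Some (n, i) then G n i else x0.
have gG n : range (G n) `<=` range g.
  by move=> _ [i _ <-]; exists (choice.pickle (n, i)) => //; rewrite /g choice.pickleK.
exists g; split=> [x /g0U|s sg y yP]; first exact: (gG 0%N).
have x0G x : range g x -> exists n, range (G n) x.
  move=> [k _ <-]; rewrite /g; case: (choice.unpickle k) => [[n i]|]; first by exists n, i.
  (* The default [x0] of [g] occurs in stage 1, where it is read past the end of a list. *)
  exists 1%N; rewrite /G /= /step.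
  exists (choice.pickle ([::0%N], (size (g0 0%N :: Phi [::g0 0%N])).+1)) => //.
  by rewrite choice.pickleK nth_default //=; lia.
have [n sG] : exists n, forall x, x \in s -> range (G n) x.
  elim: s sg {yP} => [|x s IH] sg; first by exists 0%N.
  have [|n nP] := IH; first by move=> z zs; apply: sg; rewrite inE zs orbT.
  have [m mP] := x0G x (sg x (mem_head _ _)).
  exists (maxn n m) => z; rewrite inE => /predU1P[->|/nP].
    by apply: Gmono mP; rewrite leq_maxr.
  by apply: Gmono; rewrite leq_maxl.
have [t ts] := range_map sG.
apply: (gG n.+1); exists (choice.pickle (t, (size s + index y (Phi s))%N)) => //=.
by rewrite /step choice.pickleK ts nth_cat ltnNge leq_addr /= addKn nth_index.
Qed.

(** * Connectivity, directions and ends *)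

Section Connectivity.
Variable G : sgraph.
Implicit Types (D E : set G) (X Y Z : {fset G}) (x y z : G) (r : nat -> G).

(** [connected_off] deletes finite sets only; here the complement of [D] may be infinite, as for the
    components of [G - U] with [U] countable. *)
Definition connected_in D x y := exists s : seq G,
  [/\ path (@adj G) x s, last x s = y & forall z, z \in x :: s -> D z].

Lemma connected_offE X x y : connected_off X x y = connected_in (~` [set` X]) x y.
Proof.
apply/propext; split=> -[s [xs sy sX]]; exists s; split=> // z /sX; first by move/negP.
by move=> /negP.
Qed.

Lemma connected_in_sub D E x y : D `<=` E -> connected_in D x y -> connected_in E x y.
Proof. by move=> DE [s [xs sy sD]]; exists s; split=> // z /sD/DE. Qed.

Lemma connected_in_refl D x : D x -> connected_in D x x.
Proof. by move=> Dx; exists [::]; split=> // z; rewrite inE => /eqP->. Qed.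

Lemma connected_in_trans D x y z :
  connected_in D x y -> connected_in D y z -> connected_in D x z.
Proof.
move=> [s [xs sy sD]] [t [yt tz tD]]; exists (s ++ t); split.
- by rewrite cat_path xs sy yt.
- by rewrite last_cat sy.
- move=> w; rewrite -cat_cons mem_cat => /orP[/sD//|wt].
  by apply: tD; rewrite inE wt orbT.
Qed.

Lemma connected_in_adj D x y : adj x y -> D x -> D y -> connected_in D x y.
Proof.
move=> xy Dx Dy; exists [:: y]; split=> //=; first by rewrite xy.
by move=> z; rewrite !inE => /orP[]/eqP->.
Qed.

Lemma connected_in_ind D (P : G -> Prop) x y : D x -> P x ->
  (forall u v, D u -> P u -> adj u v -> D v -> P v) -> connected_in D x y -> P y.
Proof.
move=> Dx Px step [s [xs <-]]; elim: s x Dx Px xs => [//|z s IH] x Dx Px /= /andP[xz zs] sD.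
have Dz : D z by apply: sD; rewrite !inE eqxx orbT.
by apply: (IH z Dz) => //; [exact: (step x)|move=> w ws; apply: sD; rewrite inE ws orbT].
Qed.

Lemma connected_inl D x y : connected_in D x y -> D x.
Proof. by move=> [s [_ _]]; apply; exact: mem_head. Qed.

Lemma connected_in_sym D x y : connected_in D x y -> connected_in D y x.
Proof.
move=> xy; have Dx := connected_inl xy.
apply: (connected_in_ind (P := fun y => connected_in D y x)) xy => //.
  exact: connected_in_refl.
move=> u v Du ux uv Dv; apply: connected_in_trans ux.
by apply: connected_in_adj => //; rewrite adj_sym.
Qed.

Lemma connected_inr D x y : connected_in D x y -> D y.
Proof. by move=> /connected_in_sym/connected_inl. Qed.

Lemma connected_in_self D x y :
  connected_in D x y -> connected_in (connected_in D x) x y.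
Proof.
move=> xy; have Dx := connected_inl xy.
apply: (connected_in_ind (P := connected_in (connected_in D x) x)) (xy) => //.
  by apply/connected_in_refl/connected_in_refl.
move=> u v Du xu uv Dv; apply: (connected_in_trans xu); apply: connected_in_adj => //.
  exact: connected_inr xu.
by apply: connected_in_trans (connected_inr xu) _; exact: connected_in_adj.
Qed.

Lemma ray_connected D r n m : is_ray r -> (forall k, (n <= k <= m)%N -> D (r k)) ->
  (n <= m)%N -> connected_in D (r n) (r m).
Proof.
move=> [_ ra]; elim: m => [|m IH] rD nm.
  by move: nm; rewrite leqn0 => /eqP n0; subst n; apply/connected_in_refl/rD.
have [n_eq|nm'] := eqVneq n m.+1; first by rewrite -n_eq; apply/connected_in_refl/rD; lia.
apply: (connected_in_trans (y := r m)); first by apply: IH => [k ?|]; [apply: rD|]; lia.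
by apply: connected_in_adj => //; apply: rD; lia.
Qed.

Lemma ray_leave r X : is_ray r -> exists n, forall m, (n <= m)%N -> r m \notin X.
Proof.
move=> [ri _].
have : finite_set (r @^-1` [set` X]).
  by apply: finite_preimage => [i j _ _ /ri//|]; exact: finite_fset.
move=> /finite_seqP[s sE].
exists (\max_(i <- s) i).+1 => m sm; apply/negP => rX.
have : m \in s by have : (r @^-1` [set` X]) m by []; rewrite sE.
by move=> ms; have := @leq_bigmax_seq _ s xpredT id m ms isT; lia.
Qed.

Implicit Types f h : direction G.

Lemma dir_notin f X x : f X x -> x \notin X.
Proof.
have [z zX ->] := dir_component f X; rewrite /= connected_offE => /connected_inr /=.
by move/negP.
Qed.

Lemma dir_ex f X : exists x, f X x.
Proof.
have [z zX ->] := dir_component f X; exists z; rewrite /= connected_offE.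
by apply: connected_in_refl; apply/negP.
Qed.

Lemma dir_close f X x y : f X x -> connected_off X x y -> f X y.
Proof.
have [z zX ->] := dir_component f X; rewrite /= !connected_offE; exact: connected_in_trans.
Qed.

Lemma dir_conn_off f X x y : f X x -> f X y -> connected_off X x y.
Proof.
have [z zX ->] := dir_component f X; rewrite /= !connected_offE => zx zy.
exact: connected_in_trans (connected_in_sym zx) zy.
Qed.

Lemma dir_adj f X x y : f X x -> adj x y -> y \notin X -> f X y.
Proof.
move=> fx xy yX; apply: (dir_close fx); rewrite connected_offE.
by apply: connected_in_adj => //; [apply/negP; exact: dir_notin fx|apply/negP].
Qed.

Lemma dir_close_in f X D x y : f X x -> connected_in D x y ->
  (forall z, D z -> z \notin X) -> f X y.
Proof.
move=> fx xy DX; apply: (dir_close fx); rewrite connected_offE.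
by apply: connected_in_sub xy => z /DX/negP.
Qed.

Lemma dir_conn f X x y : f X x -> f X y -> connected_in (f X) x y.
Proof.
move=> fx fy; have := dir_conn_off fx fy; rewrite connected_offE => /connected_in_self.
apply: connected_in_sub => z; rewrite -connected_offE; exact: dir_close.
Qed.

Lemma dir_eq f h X x : f X x -> h X x -> f X = h X.
Proof.
by move=> fx hx; apply/seteqP; split=> y /[dup] fy;
  [move/(dir_conn_off fx)/(dir_close hx)|move/(dir_conn_off hx)/(dir_close fx)].
Qed.

Lemma dir_sub f X X' x : {subset X <= X'} -> f X' x -> f X x.
Proof. by move=> /fsubsetP/(@dir_mono _ f); apply. Qed.

Lemma direction_ext f h : (forall X, f X = h X) -> f = h.
Proof.
case: f h => [f fc fm] [h hc hm] /= fh; have {}fh : f = h by apply/funext.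
by subst h; congr Direction; exact: Prop_irrelevance.
Qed.

Lemma direction_neq f h : h <> f -> exists X, h X <> f X.
Proof.
move=> hf; apply: contrapT => H; apply: hf; apply: direction_ext => X.
by apply: contrapT => ?; apply: H; exists X.
Qed.

(** For a ray this is membership in the end of [f], by [end_ofE], but free of the choice made in
    [end_of]. *)
Definition converges f r := forall X, exists n, forall m, (n <= m)%N -> f X (r m).

Lemma ray_tail_dir f X r n : is_ray r -> (forall m, (n <= m)%N -> r m \notin X) ->
  forall m k, (n <= m)%N -> (n <= k)%N -> f X (r m) -> f X (r k).
Proof.
move=> rr rX m k nm nk fm; apply: (dir_close fm); rewrite connected_offE.
have [mk|/ltnW km] := leqP m k.
  by apply: ray_connected => // i ?; apply/negP/rX; lia.
by apply/connected_in_sym/ray_connected => // i ?; apply/negP/rX; lia.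
Qed.

(** A tail of [r] avoids [X] and so stays in one component of [G - X]; a single visit of that tail
    to [f X] decides which one. *)
Lemma converges_freq f r : is_ray r ->
  (forall X n, exists2 m, (n <= m)%N & f X (r m)) -> converges f r.
Proof.
move=> rr H X; have [n rX] := ray_leave X rr.
have [m nm fm] := H X n; exists m => k mk.
by apply: (ray_tail_dir rr rX _ _ fm); lia.
Qed.

Lemma not_converges f r : is_ray r -> ~ converges f r ->
  exists X n, forall m, (n <= m)%N -> ~ f X (r m).
Proof.
move=> rr; rewrite -existsNP => -[X /forallNP H].
have [n rX] := ray_leave X rr; exists X, n => m nm fm.
by apply: (H n) => k nk; apply: (ray_tail_dir rr rX nm nk fm).
Qed.

Definition ray_comp r X : set G :=
  [set y | exists n, forall m, (n <= m)%N -> connected_off X y (r m)].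

Lemma ray_comp_tail r X : is_ray r -> exists n, forall m, (n <= m)%N -> ray_comp r X (r m).
Proof.
move=> rr; have [n rX] := ray_leave X rr; exists n => m nm; exists m => k mk.
by rewrite connected_offE; apply: ray_connected => // i ?; apply/negP/rX; lia.
Qed.

Lemma ray_compE r X n : is_ray r -> (forall m, (n <= m)%N -> r m \notin X) ->
  ray_comp r X = [set y | connected_off X (r n) y].
Proof.
move=> rr rX; have rc m : (n <= m)%N -> connected_off X (r n) (r m).
  by move=> nm; rewrite connected_offE; apply: ray_connected => // i ?; apply/negP/rX; lia.
apply/seteqP; split=> y /=.
  move=> [k kP]; have := kP (maxn n k) (leq_maxr _ _); have := rc (maxn n k) (leq_maxl _ _).
  by rewrite !connected_offE => + /connected_in_sym; exact: connected_in_trans.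
rewrite connected_offE => /connected_in_sym yn; exists n => m /rc.
by rewrite !connected_offE; exact: connected_in_trans.
Qed.

Lemma ray_comp_component r : is_ray r -> forall X, component X (ray_comp r X).
Proof.
move=> rr X; have [n rX] := ray_leave X rr.
by exists (r n); [exact: rX|exact: ray_compE].
Qed.

Lemma ray_comp_mono r (X X' : {fset G}) : fsubset X X' -> ray_comp r X' `<=` ray_comp r X.
Proof.
move=> /fsubsetP XX' y [n nP]; exists n => m /nP; rewrite !connected_offE.
by apply: connected_in_sub => z zX' /XX'.
Qed.

Definition ray_dir r (rr : is_ray r) : direction G :=
  Direction (ray_comp_component rr) (@ray_comp_mono r).

Lemma ray_dir_converges r (rr : is_ray r) : converges (ray_dir rr) r.
Proof. by move=> X; exact: ray_comp_tail. Qed.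

Definition same_tail r r' := exists a b, forall n, r (a + n)%N = r' (b + n)%N.

Lemma same_tail_sym r r' : same_tail r r' -> same_tail r' r.
Proof. by move=> [a [b ab]]; exists b, a. Qed.

Lemma same_tail_converges f r r' : same_tail r r' -> converges f r -> converges f r'.
Proof.
move=> [a [b ab]] fr X; have [n nP] := fr X; exists (b + n)%N => m bm.
by rewrite -(subnKC (leq_trans (leq_addr _ _) bm)) -ab; apply: nP; lia.
Qed.

Lemma converges_equiv f r r' : converges f r -> converges f r' -> ray_equiv r r'.
Proof.
move=> fr fr' [X sX]; have [n nP] := fr X; have [m mP] := fr' X.
apply: (sX (r n) (r' m)); [by exists n|by exists m|].
by apply: (@dir_conn_off f); [exact: nP|exact: mP].
Qed.

Lemma equiv_converges f r r' : is_ray r -> is_ray r' -> ray_equiv r r' ->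
  converges f r -> converges f r'.
Proof.
move=> rr rr' e fr; apply: converges_freq => // X m; have [n nP] := fr X.
(* If the goal fails, then outside these initial segments [r] lies in [f X] and [r'] avoids it, so
   [X'] separates the two rays. *)
pose X' := (X `|` [fset r i | i in iota 0 n] `|` [fset r' i | i in iota 0 m])%fset.
apply: contrapT => H; apply: e; exists X' => a b [i _ <-] [j _ <-] c.
have rX k : (k < n)%N -> r k \in X'.
  by move=> kn; rewrite !in_fsetE (in_imfset _ r) ?orbT //= mem_iota.
have rX' k : (k < m)%N -> r' k \in X'.
  by move=> kn; rewrite !in_fsetE (in_imfset _ r') ?orbT //= mem_iota.
move: c; rewrite connected_offE => c.
have ni : (n <= i)%N by rewrite leqNgt; apply/negP => /rX; have := connected_inl c.
have mj : (m <= j)%N by rewrite leqNgt; apply/negP => /rX'; have := connected_inr c.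
apply: H; exists j => //; apply: dir_close_in (nP i ni) c _ => z zX'.
by apply: contra_notN zX' => zX; rewrite /= !in_fsetE zX.
Qed.

Lemma end_of_converges f r0 : end_of f r0 -> converges f r0.
Proof.
rewrite /end_of; case: xgetP => [w _ [_ wf] wr0 X|//].
exact: wf.
Qed.

(** The class of [r0] is an end that defines [f], which rules out the default value of [xget]. *)
Lemma end_ofE f r0 : is_ray r0 -> converges f r0 ->
  forall r, end_of f r <-> is_ray r /\ converges f r.
Proof.
move=> rr0 fr0; rewrite /end_of; case: xgetP => [w _ [[r1 rr1 ->] wf]|H]; last first.
  exfalso; apply: (H [set r' | is_ray r' /\ ray_equiv r0 r']); split; first by exists r0.
  by move=> X r /= [rr e]; exact: (equiv_converges rr0 rr e).
have fr1 : converges f r1.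
  move=> X; apply: wf; split=> // -[Y sY]; have [n nP] := ray_leave Y rr1.
  apply: (sY (r1 n) (r1 n)); [by exists n|by exists n|].
  by rewrite connected_offE; apply/connected_in_refl/negP/nP.
move=> r; split=> [[rr e]|[rr fr]]; first by split=> //; exact: (equiv_converges rr1 rr e).
by split=> //; exact: converges_equiv fr1 fr.
Qed.

Lemma end_of_is_ray f r : end_of f r -> is_ray r.
Proof. by rewrite /end_of; case: xgetP => // w _ [[r1 _ ->] _] []. Qed.

Lemma end_ofP f r0 : end_of f r0 -> forall r, end_of f r <-> is_ray r /\ converges f r.
Proof. by move=> /[dup] /end_of_is_ray ? /end_of_converges; exact: end_ofE. Qed.

End Connectivity.

(** * Directions that are not countably determined *)

Lemma countable_range (I : countType) (T : Type) (g : I -> T) : countable (range g).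
Proof. exact: sub_countable (card_image_le _ _) (countableP _). Qed.

Section Determined.
Variables (G : sgraph) (f : direction G).
Implicit Types (X Y Z W : {fset G}) (x y z : G) (r : nat -> G).

Lemma connected_fset (D : set G) x (T : {fset G}) :
  D x -> (forall y, D y -> connected_in D x y) ->
  exists T' : {fset G}, (forall y, y \in T' -> D y) /\
    forall y, y \in T -> D y -> connected_in [set` T'] x y.
Proof.
move=> Dx Dconn.
have /choice[p pP] y : exists s : seq G, D y ->
    [/\ path (@adj G) x s, last x s = y & forall z, z \in x :: s -> D z].
  have [/Dconn[s sP]|nDy] := pselect (D y); first by exists s.
  by exists [::].
pose A := \bigcup_(y in [set y | y \in T /\ D y]) [set` x :: p y].
have /finite_fsetP[T' T'E] : finite_set A.
  apply: bigcup_finite => [|y _]; last exact: finite_seq.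
  by apply: sub_finite_set (finite_fset T) => y [].
have inT' y : y \in T' <-> A y by rewrite T'E.
exists T'; split=> [y /inT'[z [zT Dz]]|y yT Dy]; first by have [_ _] := pP z Dz; apply.
have [ps pl _] := pP y Dy; exists (p y); split=> // z zp.
by apply/inT'; exists y.
Qed.

(** Suppose [h] agrees with [f] on every union of [Z] with a petal. Given [T], some petal avoids
    both [T] and a finite part [T'] of [f Z] that links [a] to the vertices of [T] in [f Z]. Since
    [a] is cut off, the component chosen by [f] at this petal avoids [T]. It is connected and meets
    both [f T] and [h T], so these coincide. *)
Lemma sunflower_determined Z a (F : set {fset G}) :
  infinite_set F -> trivIset F (fun W => [set` W]) -> f Z a ->
  (forall W, F W -> ~ f (Z `|` W)%fset a) -> countably_determined f.
Proof.
move=> /infinite_enum[g gI gF] tF fa Fa.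
exists (range (fun n => ((Z `|` g n)%fset, f (Z `|` g n)%fset))); split.
- exact: countable_range.
- by move=> _ [n _ <-]; exact: dir_component.
move=> h /direction_neq[T hT]; apply: contrapT => H.
have hf n : h (Z `|` g n)%fset = f (Z `|` g n)%fset.
  by apply: contrapT => ?; apply: H; eexists; first by exists n.
have [|T' [T'D T'P]] := @connected_fset (f Z) a T fa; first by move=> y; exact: dir_conn.
have tg : trivIset [set: nat] (fun n => [set` g n]).
  by move=> i j _ _ ij; apply: gI; apply: tF ij; apply: gF; [exists i|exists j].
have [n _ gn0] := infinite_avoid tg infinite_nat (finite_fset (T `|` T')%fset).
have gn z : z \in g n -> z \notin T /\ z \notin T'.
  move=> zg; apply/andP; rewrite -negb_or -in_fsetU; apply/negP => zT.
  by have : ([set` g n] `&` [set` (T `|` T')%fset]) z by []; rewrite gn0.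
have DT y : f (Z `|` g n)%fset y -> y \notin T.
  move=> fy; apply/negP => yT.
  have fZy : f Z y by apply: dir_sub fy => z zZ; rewrite inE zZ.
  apply: (Fa (g n)); first by apply: gF; exists n.
  apply: (dir_close_in fy (connected_in_sym (T'P y yT fZy))) => z /= zT'.
  rewrite inE negb_or (dir_notin (T'D z zT')) /=.
  by apply/negP => /gn[_]; rewrite zT'.
apply: hT; pose X := (T `|` (Z `|` g n))%fset.
have TX : {subset T <= X} by move=> z zT; rewrite inE zT.
have gX : {subset (Z `|` g n)%fset <= X} by move=> z zT; rewrite inE zT orbT.
have [[y fy] [y' hy']] := (dir_ex f X, dir_ex h X).
have fy' : f (Z `|` g n)%fset y' by rewrite -hf; exact: dir_sub hy'.
apply/esym/(dir_eq (x := y')); last exact: dir_sub hy'.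
by apply: dir_close_in (dir_sub TX fy) (dir_conn (dir_sub gX fy) fy') _ => z /DT.
Qed.

(** Take a maximal family of disjoint sets outside [Z], each of which together with [Z] cuts [a] off
    from [f]. It is finite by [sunflower_determined], and [M] is its union: a separator missing [M]
    outside [Z] would enlarge the family. *)
Lemma finite_transversal Z a : ~ countably_determined f -> f Z a ->
  exists M : {fset G}, forall Y, {subset Z <= Y} -> ~ f Y a ->
    exists y, [/\ y \in M, y \in Y & y \notin Z].
Proof.
move=> ncd fa; pose disj W W' := [set` W] `&` [set` W'] = set0 :> set G.
have [F [FP Fdisj Fmax]] := maximal_pairwise
  [set W | [set` W] `&` [set` Z] = set0 /\ ~ f (Z `|` W)%fset a] disj.
have finF : finite_set F.
  apply: contrapT => infF; apply: ncd; apply: (sunflower_determined infF _ fa).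
    move=> W W' FW FW' WW'; apply: contrapT => ne.
    by move: WW'; rewrite (Fdisj W W') // => -[].
  by move=> W /FP[].
have /finite_fsetP[M ME] : finite_set (\bigcup_(W in F) [set` W]).
  by apply: bigcup_finite => // W _; exact: finite_fset.
exists M => Y ZY nfY; apply: contrapT => H.
pose W := (Y `\` Z)%fset.
have YE : (Z `|` W)%fset = Y.
  by apply/fsetP => y; rewrite !inE; have := ZY y; case: (y \in Z) => //= ->.
have WM y : y \in W -> y \notin M.
  by rewrite inE => /andP[yZ yY]; apply/negP => yM; apply: H; exists y.
have FW : F W.
  apply: Fmax => /= [|W' FW' _].
    split; last by rewrite YE.
    by apply/disjoints_subset => y /=; rewrite inE => /andP[/negP].
  have WW' : [set` W] `&` [set` W'] = set0.
    apply/disjoints_subset => y /= /WM /negP yM yW'; apply: yM.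
    by suff : [set` M] y by []; rewrite -ME; exists W'.
  by split; rewrite /disj // setIC.
(* As a member of [F], the set [W] is contained in [M], which it avoids; hence it is empty. *)
apply: nfY; suff -> : Y = Z by [].
suff W0 : W = fset0 by rewrite -YE W0 fsetU0.
apply/fsetP => y; rewrite [RHS]inE; apply/negP => yW.
have /negP := WM y yW; apply; suff : [set` M] y by [].
by rewrite -ME; exists W.
Qed.

(* The trace of a closed set on a finite separator Y separates as much as Y. *)
Definition trace_closed (U : set G) :=
  forall Y X a, [set` X] = [set` Y] `&` U -> U a -> f X a -> f Y a.

(** Close [U] under the map that sends [a] and a finite set [X] to the transversal of
    [finite_transversal]. If [X] is the trace of [Y] but only [Y] cuts [a] off, this transversal
    contains a vertex of [Y] outside [X]; by closedness that vertex lies in the trace. *)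
Lemma trace_closure U : ~ countably_determined f -> countable U ->
  exists g : nat -> G, U `<=` range g /\ trace_closed (range g).
Proof.
move=> ncd cU; have [x0 _] := dir_ex f fset0.
have /choice[M MP] (aZ : G * {fset G}) : exists M : {fset G},
    f aZ.2 aZ.1 -> forall Y, {subset aZ.2 <= Y} -> ~ f Y aZ.1 ->
    exists y, [/\ y \in M, y \in Y & y \notin aZ.2].
  have [/(finite_transversal ncd)[M MP]|nf] := pselect (f aZ.2 aZ.1); last by exists fset0.
  by exists M.
pose toF (z : seq G) := [fset x in z]%fset.
have [g [Ug gP]] := countable_closure
  (fun s => if s is a :: z then enum_fset (M (a, toF z)) else [::]) x0 cU.
exists g; split=> // Y X a XE ga fXa; apply: contrapT => nfY.
have XY x : x \in X -> x \in Y /\ range g x.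
  by move=> xX; have : [set` X] x by []; rewrite XE => -[].
have [|y [yM yY yX]] := MP (a, X) fXa Y _ nfY; first by move=> x /XY[].
have XX : toF (enum_fset X) = X by apply/fsetP => z; rewrite !inE.
move/negP: yX; apply; suff : [set` X] y by []; rewrite XE; split=> //.
apply: (gP (a :: enum_fset X)) => [x|]; last by rewrite /= XX.
by rewrite inE => /predU1P[->//|/XY[]].
Qed.

(** Domination of the end, expressed by finite separators instead of fans; see [dominates_endE]. *)
Definition dominating v := forall X, v \notin X -> f X v.

(** If a finite [Z] held all dominating vertices, then [a] and every vertex of its transversal [M]
    outside [Z] could be cut off by finite sets [S b], with union [Y]. Some neighbour of the
    component of [f] at the union of [Z] and [Y] would then lie in [M] and outside [Z]. Such a
    neighbour [y] is not cut off by [S y]. *)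
Lemma dominating_infinite : ~ countably_determined f -> infinite_set dominating.
Proof.
move=> ncd /finite_fsetP[Z ZE]; have domZ v : dominating v -> v \in Z.
  by move=> dv; suff : [set` Z] v by []; rewrite -ZE.
have [a fa] := dir_ex f Z; have [M MP] := finite_transversal ncd fa.
have /choice[S SP] b : exists S : {fset G}, b \notin Z -> b \notin S /\ ~ f S b.
  have [dom|] := pselect (dominating b); first by exists fset0; rewrite domZ.
  by rewrite -existsNP => -[S /not_implyP ?]; exists S.
have /finite_fsetP[Y YE] : finite_set (\bigcup_(b in [set` (a |` M)%fset]) [set` S b]).
  by apply: bigcup_finite => [|b _]; exact: finite_fset.
have SY b : b \in (a |` M)%fset -> {subset S b <= (Z `|` Y)%fset}.
  move=> bM y yS; rewrite inE; apply/orP; right; suff : [set` Y] y by [].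
  by rewrite -YE; exists b.
(* Only [Z] and the boundary of the component are kept: the component stays the same, and every
   vertex outside [Z] is now adjacent to it. *)
pose Y' := [fset y in (Z `|` Y)%fset |
  (y \in Z) || `[< exists2 z, f (Z `|` Y)%fset z & adj z y >]]%fset.
have YY' : {subset Y' <= (Z `|` Y)%fset} by move=> y; rewrite !inE => /andP[].
have nfa : ~ f Y' a.
  move=> fY'a; have [w fw] := dir_ex f (Z `|` Y)%fset.
  have fa' : f (Z `|` Y)%fset a.
    have := dir_conn (dir_sub YY' fw) fY'a.
    apply: connected_in_ind => // [|u v _ fu uv fv]; first exact: dir_sub fw.
    apply: (dir_adj fu uv); apply/negP => vZY.
    have /negP := dir_notin fv; apply; rewrite !inE /= -in_fsetU vZY /=.
    by apply/orP; right; apply/asboolP; exists u.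
  apply: (SP a (dir_notin fa)).2.
  by apply: dir_sub fa'; apply: SY; rewrite fset1U1.
have [|y [yM yY' yZ]] := MP Y' _ nfa; first by move=> z zZ; rewrite !inE zZ.
have [yS nfy] := SP y yZ; apply: nfy.
move: yY'; rewrite !inE /= (negbTE yZ) /= => /andP[_ /asboolP[z fz zy]].
by apply: dir_adj (dir_sub _ fz) zy yS; apply: SY; rewrite inE yM orbT.
Qed.

End Determined.

(** * Rays, double rays and fans *)

Lemma dependent_choice_inv (X : Type) (P : X -> Prop) (R : X -> X -> Prop) (x0 : X) :
  P x0 -> (forall x, P x -> exists2 y, P y & R x y) ->
  exists u : nat -> X, forall n, P (u n) /\ R (u n) (u n.+1).
Proof.
move=> P0 PR; have /choice[s sP] x : exists y, P x -> P y /\ R x y.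
  by have [/PR[y Py xy]|] := pselect (P x); [exists y|exists x].
have Pn n : P (iter n s x0) by elim: n => [//|n IH]; have [] := sP _ IH.
by exists (fun n => iter n s x0) => n; split=> //; have [] := sP _ (Pn n).
Qed.

Section Rays.
Variables (G : sgraph).
Implicit Types (D E : set G) (f h : direction G) (X Y Z A : {fset G}).
Implicit Types (x y z v : G) (d : int -> G) (r : nat -> G).

Lemma ray_of_steps (A : nat -> {fset G}) r :
  (forall n, [/\ r n \notin A n, A n.+1 = (r n |` A n)%fset & adj (r n) (r n.+1)]) -> is_ray r.
Proof.
move=> H; split; last by move=> n; have [] := H n.
have rA n m : (n < m)%N -> r n \in A m.
  elim: m => [//|m IH]; rewrite ltnS leq_eqVlt => /predU1P[->|/IH nA].
    by have [_ -> _] := H m; rewrite fset1U1.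
  by have [_ -> _] := H m; rewrite inE nA orbT.
have lt n m : (n < m)%N -> r n <> r m.
  by move=> /rA + nm; rewrite nm; have [/negP] := H m.
move=> n m nm; have [/lt|/lt|//] := ltngtP n m; first by [].
by move=> /(_ (esym nm)).
Qed.

(** A walk inside [h X] towards [v] that starts in the component chosen after deleting [v] too can
    leave this component only by stepping onto [v]. *)
Lemma dir_next h X v : h X v -> exists2 w, h (v |` X)%fset w & adj v w.
Proof.
move=> hv; have [w hw] := dir_ex h (v |` X)%fset.
have XX : {subset X <= (v |` X)%fset} by move=> z zX; rewrite inE zX orbT.
pose P u := h (v |` X)%fset u \/ exists2 w, h (v |` X)%fset w & adj v w.
have : P v; last by case=> // /dir_notin; rewrite fset1U1.
have hw' := dir_sub XX hw.
apply: (connected_in_ind (P := P) hw' _ _ (dir_conn hw' hv)); first by left.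
move=> u z _ [hu|//] uz hz; last by right.
have [zv|zv] := eqVneq z v; first by right; exists u => //; rewrite adj_sym -zv.
by left; apply: dir_adj hu uz _; rewrite !inE negb_or zv (dir_notin hz).
Qed.

Lemma dir_ray h Y : exists2 r, is_ray r & range r `<=` h Y.
Proof.
have [x hx] := dir_ex h Y.
have [|[A v] /= [YA hv]|u uP] := dependent_choice_inv
  (P := fun s : {fset G} * G => {subset Y <= s.1} /\ h s.1 s.2)
  (R := fun s t => t.1 = (s.2 |` s.1)%fset /\ adj s.2 t.2) (x0 := (Y, x)) _ _.
- by split.
- have [w hw vw] := dir_next hv; exists ((v |` A)%fset, w) => //=; split=> // z /YA zA.
  by rewrite inE zA orbT.
exists (fun n => (u n).2).
  apply: (@ray_of_steps (fun n => (u n).1)) => n.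
  by have [[_ /dir_notin ?] []] := uP n.
by move=> _ [n _ <-]; have [[YA hn] _] := uP n; exact: dir_sub hn.
Qed.

(** Link infinitely many dominating vertices one after the other, each time avoiding the vertices
    already visited. The ray meets every [f X] again and again, because a dominating vertex outside
    [X] lies in [f X]. *)
Lemma converging_ray f : ~ countably_determined f ->
  exists2 r, is_ray r & converges f r.
Proof.
move=> /dominating_infinite infD.
have next X : exists2 w, w \notin X & dominating f w.
  have /infinite_setD/(_ (finite_fset X)) := infD.
  by move=> /infinite_setN0[w [dw /negP wX]]; exists w.
have [x _ dx] := next fset0.
(* A state consists of the visited vertices, the current vertex and the rest of a planned path to a
   dominating vertex. A new path is planned only when the rest is empty. *)
pose P (s : {fset G} * (G * seq G)) := [/\ path (@adj G) s.2.1 s.2.2,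
  uniq (s.2.1 :: s.2.2), forall z, z \in s.2.1 :: s.2.2 -> z \notin s.1 &
  dominating f (last s.2.1 s.2.2)].
pose R (s t : {fset G} * (G * seq G)) := [/\ t.1 = (s.2.1 |` s.1)%fset, adj s.2.1 t.2.1 &
  s.2.2 <> [::] -> s.2.2 = t.2.1 :: t.2.2].
have [||u uP] := @dependent_choice_inv _ P R (fset0, (x, [::])).
- by split=> // z; rewrite inE.
- move=> [A [v q]]; rewrite /P /R /=.
  have cons_ok w s : path (@adj G) v (w :: s) -> uniq (v :: w :: s) ->
      (forall z, z \in v :: w :: s -> z \notin A) -> dominating f (last w s) ->
      (q <> [::] -> q = w :: s) ->
      exists2 y : {fset G} * (G * seq G),
      [/\ path (@adj G) y.2.1 y.2.2, (y.2.1 \notin y.2.2) && uniq y.2.2,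
          forall z, z \in y.2.1 :: y.2.2 -> z \notin y.1 & dominating f (last y.2.1 y.2.2)] &
      [/\ y.1 = (v |` A)%fset, adj v y.2.1 & q <> [::] -> q = y.2.1 :: y.2.2].
    move=> /= /andP[vw ws] /andP[vws wsu] sA ds qE.
    exists ((v |` A)%fset, (w, s)); split=> //= z zs.
    rewrite in_fset1U negb_or (sA z) ?andbT; last by rewrite inE zs orbT.
    by apply: contraNneq vws => <-.
  case: q cons_ok => [|w s] cons_ok [pq uq qA dq]; last exact: (cons_ok w s).
  have [w wX dw] := next (v |` A)%fset.
  have vA : v \notin A by apply: qA; rewrite mem_head.
  move: wX; rewrite !inE negb_or => /andP[wv wA].
  have [s [ps ls sA]] := dir_conn_off (dq A vA) (dw A wA).
  case/shortenP: ps ls => -[|w' s'] ps' us' ss' ls'; first by rewrite -ls' eqxx in wv.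
  apply: (cons_ok w' s') => //; last by rewrite -[last w' s']/(last v (w' :: s')) ls'.
  by move=> z; rewrite inE => /predU1P[->//|/ss' zs]; apply: sA; rewrite inE zs orbT.
pose r n := (u n).2.1.
have rr : is_ray r.
  apply: (@ray_of_steps (fun n => (u n).1)) => n.
  have [[_ _ nA _] [-> ? _]] := uP n; split=> //.
  by apply: nA; exact: mem_head.
(* Following a plan of length [k] takes [k] steps and ends in a dominating vertex. *)
have domr k : forall n, size (u n).2.2 = k -> dominating f (r (n + k)%N).
  elim: k => [|k IH] n; have [[_ _ _ dn] [_ _ un]] := uP n.
    by move=> /size0nil un0; move: dn; rewrite un0 addn0.
  move=> nk; rewrite addnS -addSn; apply: IH.
  case: (u n).2.2 nk un => [//|w s] /= [<-] un.
  by have /un[_ <-] : w :: s <> [::] by [].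
exists r => //; apply: converges_freq => // X n.
have [n0 rX] := ray_leave X rr.
exists (maxn n n0 + size (u (maxn n n0)).2.2)%N; first by lia.
by apply: domr => //; apply: rX; lia.
Qed.

Lemma ray_shift r k : is_ray r -> is_ray (fun n => r (k + n)%N).
Proof.
by move=> [ri ra]; split=> [i j /ri/addnI//|n]; rewrite addnS.
Qed.

Lemma same_tail_refl r : same_tail r r.
Proof. by exists 0%N, 0%N. Qed.

Lemma same_tail_shift r r' k : same_tail r r' -> same_tail r (fun n => r' (k + n)%N).
Proof.
move=> [a [b ab]]; exists (a + k)%N, b => n.
by rewrite -addnA ab; congr r'; lia.
Qed.

Definition ray_cons x r n := if n is m.+1 then r m else x.

Lemma ray_cons_ray x r : is_ray r -> adj x (r 0%N) -> ~ range r x -> is_ray (ray_cons x r).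
Proof.
move=> [ri ra] xr nx; split=> [|[|n] //=].
by move=> [|i] [|j] //= => [xE|xE|/ri-> //]; case: nx; [exists j|exists i].
Qed.

Lemma same_tail_cons x r r' : same_tail r r' -> same_tail r (ray_cons x r').
Proof. by move=> [a [b ab]]; exists a, b.+1. Qed.

Lemma range_cons x r : range (ray_cons x r) `<=` x |` range r.
Proof. by move=> _ [[|n] _ <-] /=; [left|right; exists n]. Qed.

(** If [v] lies on the ray, the ray is cut off at [v]; otherwise [v] is put in front. *)
Lemma ray_prepend r r' v : is_ray r' -> same_tail r r' -> adj (r' 0%N) v ->
  exists r'', [/\ is_ray r'', r'' 0%N = v, range r'' `<=` v |` range r' & same_tail r r''].
Proof.
move=> rr' rt av; have [[k _ kv]|nv] := pselect (range r' v).
  exists (fun n => r' (k + n)%N); split;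
    [exact: ray_shift|by rewrite addn0| |exact: same_tail_shift].
  by move=> _ [n _ <-]; right; exists (k + n)%N.
exists (ray_cons v r'); split=> //; [|exact: range_cons|exact: same_tail_cons].
by apply: ray_cons_ray => //; rewrite adj_sym.
Qed.

Lemma ray_from D r x : is_ray r -> range r `<=` D -> connected_in D (r 0%N) x ->
  exists r', [/\ is_ray r', r' 0%N = x, range r' `<=` D & same_tail r r'].
Proof.
move=> rr rD; apply: (connected_in_ind (P := fun x => exists r',
  [/\ is_ray r', r' 0%N = x, range r' `<=` D & same_tail r r'])).
- by apply: rD; exists 0%N.
- by exists r; split=> //; exact: same_tail_refl.
- move=> u v _ [r' [rr' r'0 r'D rt]] uv Dv; rewrite -r'0 in uv.
  have [r'' [rr'' r''0 r''D rt']] := ray_prepend rr' rt uv.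
  by exists r''; split=> // z /r''D[->//|/r'D].
Qed.

(** Move the start of [a] along the walk towards [b], keeping the ray disjoint from [b]. When the
    next vertex lies on [b], cut [b] off there. This must happen, as the walk ends on [b]. *)
Lemma double_ray_between D a b : is_ray a -> is_ray b -> range a `<=` D -> range b `<=` D ->
  range a `&` range b = set0 -> connected_in D (a 0%N) (b 0%N) ->
  exists a' b', [/\ is_ray a' /\ is_ray b', range a' `&` range b' = set0,
    adj (a' 0%N) (b' 0%N), range a' `<=` D /\ range b' `<=` D & same_tail a a' /\ same_tail b b'].
Proof.
move=> ra rb aD bD ab0 cab; apply: contrapT => H.
have a0 : ~ range b (a 0%N).
  move=> ba; suff : (range a `&` range b) (a 0%N) by rewrite ab0.
  by split=> //; exists 0%N.
have : exists a', [/\ is_ray a', a' 0%N = b 0%N, range a' `<=` D, same_tail a a' &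
    range a' `&` range b = set0].
  apply: (connected_in_ind (P := fun x => exists a', [/\ is_ray a', a' 0%N = x,
    range a' `<=` D, same_tail a a' & range a' `&` range b = set0])) cab;
    first by apply: aD; exists 0%N.
    by exists a; split=> //; exact: same_tail_refl.
  move=> u v _ [a' [ra' a'0 a'D aa' a'b]] uv Dv; rewrite -a'0 in uv.
  have [[k _ kv]|nv] := pselect (range b v).
    case: H; exists a', (fun n => b (k + n)%N); split=> //.
    - by split=> //; exact: ray_shift.
    - apply/disjoints_subset => z az [n _ bz].
      by have : (range a' `&` range b) z by [split=> //; exists (k + n)%N]; rewrite a'b.
    - by rewrite addn0 kv.
    - by split=> // z [n _ <-]; apply: bD; exists (k + n)%N.
    - by split=> //; apply/same_tail_shift/same_tail_refl.
  have [a'' [ra'' a''0 a''D at']] := ray_prepend ra' aa' uv.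
  exists a''; split=> // [z /a''D[->//|/a'D//]|].
  apply/disjoints_subset => z /a''D[->//|az bz].
  by have : (range a' `&` range b) z by []; rewrite a'b.
move=> [a' [_ a'0 _ _ a'b]].
by have : (range a' `&` range b) (b 0%N) by [split; [exists 0%N|exists 0%N]]; rewrite a'b.
Qed.

(** [Negz n] is the integer -(n+1), so [b 0] sits at -1, next to [a 0] at 0. *)
Definition join_rays (a b : nat -> G) (z : int) : G :=
  match z with Posz n => a n | Negz n => b n end.

Lemma join_rays_double a b : is_ray a -> is_ray b -> range a `&` range b = set0 ->
  adj (a 0%N) (b 0%N) -> is_double_ray (join_rays a b).
Proof.
move=> [ai aa] [bi ba] ab0 ab.
have nab i j : a i <> b j.
  move=> E; have : (range a `&` range b) (a i) by split; [exists i|exists j].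
  by rewrite ab0.
split.
  move=> [i|i] [j|j] /=; [by move/ai->|by move/nab|by move/esym/nab|by move/bi->].
move=> [n|[|n]].
- have -> : (Posz n + 1)%R = Posz n.+1 by lia.
  exact: aa.
- have -> : (Negz 0 + 1)%R = Posz 0 by [].
  by rewrite adj_sym.
- have -> : (Negz n.+1 + 1)%R = Negz n by lia.
  by rewrite adj_sym; exact: ba.
Qed.

Lemma double_ray_tail_ray d r : is_double_ray d -> double_ray_tail d r -> is_ray r.
Proof.
move=> [di da] [k [] rE]; split=> [i j|n].
- by rewrite !rE => /di; lia.
- by rewrite !rE; have -> : (k + n.+1%:Z)%R = ((k + n%:Z) + 1)%R by lia.
- by rewrite !rE => /di; lia.
- by rewrite !rE adj_sym; have -> : (k - n%:Z)%R = ((k - n.+1%:Z) + 1)%R by lia.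
Qed.

Lemma double_ray_tail_range d r : double_ray_tail d r -> range r `<=` range d.
Proof. by move=> [k [] rE] _ [n _ <-]; rewrite rE; [exists (k + n%:Z)%R|exists (k - n%:Z)%R]. Qed.

Lemma double_ray_tail_shift d r k : double_ray_tail d r ->
  double_ray_tail d (fun n => r (k + n)%N).
Proof.
move=> [l [] rE]; [exists (l + k%:Z)%R; left|exists (l - k%:Z)%R; right] => n.
- by rewrite rE; congr d; lia.
- by rewrite rE; congr d; lia.
Qed.

Lemma double_ray_connected d : is_double_ray d ->
  forall z : int, connected_in (range d) (d 0%R) (d z).
Proof.
move=> dd; have [_ da] := dd.
have H r : double_ray_tail d r -> r 0%N = d 0%R -> forall n, connected_in (range d) (d 0%R) (r n).
  move=> dr <- n; apply: ray_connected => // [|k _]; first exact: double_ray_tail_ray dr.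
  by apply: (double_ray_tail_range dr); exists k.
move=> [n|n].
  by apply: (H (fun n => d (Posz n))) => //; exists 0%R; left => k; congr d; lia.
have := H (fun n => d (0 - Posz n)%R) _ _ n.+1.
have -> : (0 - Posz n.+1)%R = Negz n by lia.
by apply=> //; exists 0%R; right.
Qed.

(** The fan paths are disjoint outside [v], so some nontrivial one avoids [X] and the initial
    segment of [r] before its tail in [f X]. It links [v] to this tail. *)
Lemma dominates_dominating f v r : is_ray r -> converges f r -> dominates v r -> dominating f v.
Proof.
move=> rr fr [F [infF Ffan Fdisj]] X vX.
have [n rX] := fr X.
(* The vertex [v] may lie on the initial segment and is on every fan path, so it is taken out. *)
pose Y := (X `|` ([fset r i | i in iota 0 n] `\ v))%fset.
have tF : trivIset F (fun s => [set` s]).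
  move=> s t Fs Ft [z [/= zs zt]]; apply: contrapT => /(Fdisj _ _ Fs Ft)/(_ z).
  rewrite !inE zs zt !orbT => /(_ isT isT) zv; subst z.
  by have [_ /=] := Ffan s Fs; rewrite zs.
have tF' : trivIset (F `\ [::]) (fun s => [set` s]).
  by move=> s t [Fs _] [Ft _]; exact: tF.
have [] := infinite_avoid tF' (infinite_setD infF (finite_set1 _)) (finite_fset Y).
move=> s [Fs s0] sY; have [ps us [k _ rk] sR] := Ffan s Fs.
have sY' z : z \in v :: s -> z \notin Y.
  rewrite inE => /predU1P[->|zs]; first by rewrite !inE eqxx orbF.
  by apply/negP => zY; have : ([set` s] `&` [set` Y]) z by []; rewrite sY.
have lv : last v s != v.
  case: s s0 us {Fs ps sR rk sY sY'} => [[]//|w s _ /= /andP[vws _]].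
  by apply: contraNneq vws => <-; rewrite mem_last.
have nk : (n <= k)%N.
  rewrite leqNgt; apply/negP => kn; have /negP := sY' _ (mem_last v s); apply.
  have rkY : r k \in [fset r i | i in iota 0 n]%fset by rewrite (in_imfset _ r) //= mem_iota.
  by rewrite in_fsetU in_fsetD1 lv -rk rkY orbT.
apply: (dir_close (rX k nk)); rewrite connected_offE; apply: connected_in_sym.
exists s; split=> // z /sY' zY zX.
by move: zY; rewrite inE zX.
Qed.

(** A maximal fan of nontrivial paths is infinite: otherwise its vertices other than [v] form a
    finite set [Y], and a path from [v] to [r] in [G - Y], stopped at its first vertex on [r] after
    [v], extends the fan. *)
Lemma dominating_dominates f v r : is_ray r -> converges f r -> dominating f v -> dominates v r.
Proof.
move=> rr fr dv.
have [F [FP Fdisj Fmax]] := maximal_pairwise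
  [set s | fan_path v (range r) s /\ s <> [::]]
  (fun s t => forall z, z \in v :: s -> z \in v :: t -> z = v).
exists F; split; [|by move=> s /FP[]|exact: Fdisj].
move=> finF; have /finite_fsetP[Y YE] : finite_set (\bigcup_(s in F) [set` s]).
  by apply: bigcup_finite => // s _; exact: finite_seq.
have sY s : F s -> {subset s <= Y}.
  by move=> Fs z zs; suff : [set` Y] z by []; rewrite -YE; exists s.
have vY : v \notin Y.
  apply/negP => vY; have : [set` Y] v by []; rewrite -YE => -[s Fs vs].
  by have [[_ /= /andP[/negP]]] := FP s Fs.
have [n0 rY] := fr Y; have [ri ra] := rr.
have [n rn nv] : exists2 n, f Y (r n) & r n <> v.
  have [n0v|] := pselect (r n0 = v); last by exists n0 => //; exact: rY.
  by exists n0.+1; [apply: rY|rewrite -n0v => /ri; lia].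
have [s [ps ls sY']] := dir_conn_off (dv Y vY) rn.
case/shortenP: ps ls => s1 ps1 us1 ss1 ls1.
have hp : has (fun z => `[< range r z >]) s1.
  apply/hasP; exists (r n); last by apply/asboolP; exists n.
  by have := mem_last v s1; rewrite ls1 inE => /predU1P[].
have s1Y z : z \in s1 -> z \notin Y by move=> /ss1 zs; apply: sY'; rewrite inE zs orbT.
(* By maximality such a path [t] belongs to [F], so its vertices lie in [Y], which [s1] avoids. *)
have Frr : forall t, fan_path v (range r) t -> t <> [::] -> {subset t <= s1} -> False.
  move=> t ft t0 ts1.
  have tF : F t.
    apply: Fmax => // s' Fs' _; have D z : z \in v :: t -> z \in v :: s' -> z = v.
      rewrite inE => /predU1P[//|/ts1/s1Y zY]; rewrite inE => /predU1P[//|/(sY _ Fs')].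
      by rewrite (negbTE zY).
    by split=> // z zs zt; exact: D.
  case: t tF t0 ts1 {ft} => [|z t] // tF _ ts1.
  have zt := mem_head z t.
  by have := s1Y z (ts1 z zt); rewrite (sY _ tF z zt).
case/split_find: hp ps1 us1 Frr {ls1 ss1 s1Y} => x t1 t2 /asboolP rx t1r ps us Frr.
apply: (Frr (rcons t1 x)); last 2 first.
- by case: (t1).
- by move=> z zt; rewrite mem_cat zt.
split.
- by move: ps; rewrite cat_path => /andP[].
- by move: us; rewrite -cat_cons cat_uniq => /andP[].
- by rewrite last_rcons.
- move=> z; rewrite last_rcons inE mem_rcons inE => /or3P[/eqP|/eqP|zt] rz; [by left|by right|].
  by case/hasP: t1r; exists z => //; apply/asboolP.
Qed.

Lemma dominates_endE f v r0 : is_ray r0 -> converges f r0 ->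
  dominates_end v (end_of f) <-> dominating f v.
Proof.
move=> rr0 fr0; have fE := end_ofE rr0 fr0; split.
  by move=> [r /fE[rr fr]]; exact: dominates_dominating.
by move=> dv; exists r0; [exact/fE|exact: dominating_dominates dv].
Qed.

End Rays.

(** * The star-comb lemma *)

Section StarComb.
Variables (G : sgraph).
Implicit Types (f : direction G) (X Y Z : {fset G}) (x y z v : G) (r : nat -> G).

(** A breadth-first tree: [d] is the least length of a walk from [c0] with all vertices but the last
    in [C], and [p] gives the last vertex but one of such a shortest walk. The root is its own
    parent. *)
Lemma parent_tree (C N : set G) c0 : C c0 -> (forall c, C c -> connected_in C c0 c) ->
  (forall a, N a -> exists2 c, C c & adj c a) ->
  exists (p : G -> G) (d : G -> nat), p c0 = c0 /\
    forall x, C x \/ N x -> x <> c0 -> [/\ C (p x), adj (p x) x & (d (p x) < d x)%N].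
Proof.
move=> Cc0 Cconn Nadj.
pose reach n x := exists s : seq G, [/\ size s = n, path (@adj G) c0 s, last c0 s = x &
  forall z, z \in belast c0 s -> C z].
have ex_reach x : C x \/ N x -> exists n, `[< reach n x >].
  have reachC y : C y -> exists s : seq G,
      [/\ path (@adj G) c0 s, last c0 s = y & forall z, z \in c0 :: s -> C z].
    exact: Cconn.
  case=> [/reachC[s [ps ls sC]]|/Nadj[c /reachC[s [ps ls sC]] ca]].
    by exists (size s); apply/asboolP; exists s; split=> // z /mem_belast/sC.
  exists (size s).+1; apply/asboolP; exists (rcons s x); split; rewrite ?size_rcons ?last_rcons //.
    by rewrite rcons_path ps ls.
  by move=> z; rewrite belast_rcons => /sC.
have /choice[d dP] x : exists n, C x \/ N x -> reach n x /\ forall m, reach m x -> (n <= m)%N.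
  have [/ex_reach ex|] := pselect (C x \/ N x); last by exists 0%N.
  case: (ex_minnP ex) => n /asboolP rn nmin; exists n => _; split=> // m rm.
  by apply: nmin; apply/asboolP.
have /choice[p pP] x : exists y, (x = c0 -> y = c0) /\
    (C x \/ N x -> x <> c0 -> [/\ C y, adj y x & (d y < d x)%N]).
  have [->|xc0] := pselect (x = c0); first by exists c0.
  have [Bx|] := pselect (C x \/ N x); last by exists x.
  have [[s [ss ps ls sC]] _] := dP x Bx.
  case/lastP: s ss ps ls sC => [|s x'] ss ps ls sC; first by case: xc0; rewrite -ls.
  move: ls ps ss sC; rewrite last_rcons => ->; rewrite rcons_path size_rcons belast_rcons.
  move=> /andP[ps lx] sd sC; exists (last c0 s); split=> // _ _.
  have Cl : C (last c0 s) by apply: sC; exact: mem_last.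
  split=> //; rewrite -sd ltnS; have [_] := dP _ (or_introl Cl); apply.
  by exists s; split=> // z /mem_belast/sC.
exists p, d; split; first by have [+ _] := pP c0; apply.
by move=> x; have [_] := pP x.
Qed.

(** Work in the breadth-first tree. A vertex with infinitely many children below vertices of [N]
    dominates [f], since all but finitely many of these branches avoid a given finite set. If there
    is none, König's argument yields a ray along vertices with infinitely many vertices of [N] above
    them. *)
Lemma star_comb f (C N : set G) c0 : C c0 -> (forall c, C c -> connected_in C c0 c) ->
  infinite_set N -> (forall a, N a -> exists2 c, C c & adj c a) ->
  (forall Y a, N a -> a \notin Y -> f Y a) ->
  (exists2 v, C v & dominating f v) \/
  (exists r, [/\ is_ray r, range r `<=` C & converges f r]).
Proof.
move=> Cc0 Cconn infN Nadj Nf.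
have [p [d [pc0 pP]]] := parent_tree Cc0 Cconn Nadj.
pose B x := C x \/ N x.
have Bp x : B x -> C (p x) /\ (d (p x) <= d x)%N.
  move=> Bx; have [->|xc0] := pselect (x = c0); first by rewrite pc0.
  by have [? _ /ltnW ?] := pP x Bx xc0.
have Biter k x : B x -> B (iter k p x) /\ (d (iter k p x) <= d x)%N.
  move=> Bx; elim: k => [//|k [Bk dk]]; have [Ck dk'] := Bp _ Bk.
  by split; [left|exact: leq_trans dk' dk].
pose up w := [set x | B x /\ exists k, iter k p x = w].
have up_refl w : B w -> up w w by move=> Bw; split=> //; exists 0%N.
have up_conn w x : up w x -> connected_in (up w) w x.
  move=> [Bx [k kx]]; elim: k x Bx kx => [|k IH] x Bx kx.
    by rewrite -kx; apply/connected_in_refl/up_refl.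
  have Bpx : B (p x) by left; have [] := Bp x Bx.
  have kpx : iter k p (p x) = w by rewrite -iterSr.
  have [xc0|xc0] := pselect (x = c0).
    by rewrite xc0 -pc0 -xc0; exact: IH.
  apply: connected_in_trans (IH _ Bpx kpx) _; apply: connected_in_adj.
  - by have [] := pP x Bx xc0.
  - by split=> //; exists k.
  - by split=> //; exists k.+1.
pose child v w := [/\ B w, w <> c0, p w = v & exists2 a, N a & up w a].
(* If a vertex were above two children of [v], one of them would be [v] or an ancestor of [v], yet
   its depth exceeds that of [v]. *)
have up_triv v : trivIset (child v) up.
  have lt x k k' w w' : child v w -> child v w' ->
      iter k p x = w -> iter k' p x = w' -> (k < k')%N -> False.
    move=> [Bw wc0 pw _] [Bw' wc0' pw' _] kx kx' kk'.
    have E : w' = iter (k' - k).-1 p v.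
      by rewrite -pw -iterSr -kx -iterD -kx'; congr iter; lia.
    have Bv : B v by left; rewrite -pw; have [] := Bp w Bw.
    have [_] := Biter (k' - k).-1 v Bv; rewrite -E.
    by have [_ _] := pP w' Bw' wc0'; rewrite pw'; lia.
  move=> w w' cw cw' [x [[_ [k kx]] [_ [k' kx']]]].
  have [kk'|kk'|kk'] := ltngtP k k'; last by rewrite -kx -kx' kk'.
    by case: (lt _ _ _ _ _ cw cw' kx kx' kk').
  by case: (lt _ _ _ _ _ cw' cw kx' kx kk').
have up_dir w a Y : N a -> up w a -> up w `&` [set` Y] = set0 -> f Y w.
  move=> Na wa wY; have upY z : up w z -> z \notin Y.
    by move=> wz; apply/negP => zY; have : (up w `&` [set` Y]) z by []; rewrite wY.
  by apply: dir_close_in (Nf Y a Na (upY _ wa)) (connected_in_sym (up_conn _ _ wa)) _.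
have [[v [Cv infv]]|fin_child] := pselect (exists v, C v /\ infinite_set (child v)).
  left; exists v => // Y vY.
  have [w [Bw wc0 pw [a Na wa]] wY] := infinite_avoid (up_triv v) infv (finite_fset Y).
  apply: (dir_adj (up_dir w a Y Na wa wY)) => //.
  by rewrite adj_sym -pw; have [] := pP w Bw wc0.
right; pose big v := infinite_set [set a | N a /\ up v a].
have bigC v : big v -> C v.
  move=> bv; have /infinite_setN0[a [[Na [Ba [k ka]]] av]] := infinite_setD bv (finite_set1 v).
  case: k ka => [/= ?|k] //; rewrite iterS => <-.
  by have [] := Bp _ (Biter k a Ba).1.
have [||u uP] := @dependent_choice_inv _ big (fun v w => child v w) c0.
- have N_up : N `<=` [set a | N a /\ up c0 a].
    move=> a Na; split=> //; split; first by right.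
    have : B a by right.
    have [n] := ubnP (d a); elim: n a {Na} => [//|n IH] a dn Ba.
    have [->|ac0] := pselect (a = c0); first by exists 0%N.
    have [Cpa _ da] := pP a Ba ac0; have [||k kP] := IH (p a); [lia|by left|].
    by exists k.+1; rewrite iterSr.
  by move=> fin; apply: infN; exact: sub_finite_set N_up fin.
- move=> v bv; apply: contrapT => H.
  have finv : finite_set (child v).
    by apply: contrapT => ?; apply: fin_child; exists v; split=> //; exact: bigC.
  (* If no child were big, the vertices of [N] above [v] would be at most [v] itself and a finite
     union of finite sets. *)
  apply: bv; apply: (@sub_finite_set _ _
    ([set v] `|` \bigcup_(w in child v) [set a | N a /\ up w a])).
    move=> a [Na [Ba [k ka]]].
    elim: k ka => [/= ->|k IH ka]; first by left.
    have [/IH//|kv] := pselect (iter k p a = v).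
    have [Bk _] := Biter k a Ba.
    have kc0 : iter k p a <> c0.
      by move=> kc0; apply: kv; rewrite -ka iterS kc0 pc0.
    have upk : up (iter k p a) a by split=> //; exists k.
    by right; exists (iter k p a) => //; split=> //; exists a.
  rewrite finite_setU; split; first exact: finite_set1.
  by apply: bigcup_finite => // w cw; apply: contrapT => bw; apply: H; exists w.
have du n : (d (u n) < d (u n.+1))%N.
  by have [_ [Bw wc0 <- _]] := uP n; have [_ _] := pP _ Bw wc0.
have dmono n m : (n < m)%N -> (d (u n) < d (u m))%N.
  by elim: m => // m IH; rewrite ltnS leq_eqVlt => /predU1P[->//|/IH/ltn_trans]; apply.
have un_up n m : (n <= m)%N -> up (u n) (u m).
  move=> /subnK <-; elim: (m - n)%N => [|k [_ [j jP]]].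
    by apply: up_refl; left; apply: bigC; have [] := uP n.
  have [_ [Bw _ pw _]] := uP (k + n)%N; split=> //.
  by exists j.+1; rewrite iterSr pw.
exists u; split.
- split=> [n m nm|n]; last by have [_ [Bw wc0 <- _]] := uP n; have [] := pP _ Bw wc0.
  by have [/dmono|/dmono|//] := ltngtP n m; rewrite nm ltnn.
- by move=> _ [n _ <-]; apply: bigC; have [] := uP n.
(* Beyond the largest depth in [Y], the whole branch above [u n] avoids [Y], and it contains a
   vertex of [N]. *)
- move=> Y; pose M := \max_(y <- enum_fset Y) d y.
  exists M.+1 => n Mn.
  have [bn _] := uP n; have /infinite_setN0[a [Na na]] := bn.
  apply: (up_dir _ a) => //; apply/disjoints_subset => y [By [k ky]] yY.
  have [_] := Biter k y By; rewrite ky.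
  have dn m : (m <= d (u m))%N by elim: m => // m; have := du m; lia.
  have : (d y <= M)%N by exact: leq_bigmax_seq.
  by have := dn n; lia.
Qed.

End StarComb.

(** * New rays beyond a countable set *)

Section Undetermined.
Variables (G : sgraph) (f : direction G).
Implicit Types (X Y Z : {fset G}) (x y z v : G) (d : int -> G) (r : nat -> G).

Lemma trace_fset (U : set G) Y : exists X, [set` X] = [set` Y] `&` U.
Proof.
have /finite_fsetP[X XE] : finite_set ([set` Y] `&` U).
  by apply: sub_finite_set (finite_fset Y) => y [].
by exists X.
Qed.

(** The choices [(X, f X)] with [X] a finite subset of the range of an enumeration covering [U] are
    countably many, hence do not determine [f]. *)
Lemma undetermined (U : set G) : ~ countably_determined f -> countable U ->
  exists2 h, h <> f & forall X, [set` X] `<=` U -> h X = f X.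
Proof.
move=> ncd cU; have [x0 _] := dir_ex f fset0.
have [g gU] := countable_enum x0 cU.
pose X_ (s : seq nat) := [fset x in map g s]%fset.
apply: contrapT => H; apply: ncd.
exists (range (fun s => (X_ s, f (X_ s)))); split.
- exact: countable_range.
- by move=> _ [s _ <-]; exact: dir_component.
move=> h hf; apply: contrapT => nd; apply: H; exists h => // X XU.
have [s ->] : exists s, X = X_ s.
  have [t tE] : exists t, map g t = enum_fset X by apply: range_map => x /XU/gU.
  by exists t; apply/fsetP => z; rewrite !inE tE.
by apply: contrapT => ne; apply: nd; exists (X_ s, f (X_ s)); [exists s|].
Qed.

(** Let [h] agree with [f] on [U] but differ at [Y]. By closedness [h Y] contains no vertex of [U].
    So for finite [X] in [U] the set [h Y] is connected in [G - X]; it meets [h X = f X] and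
    therefore lies in it. Any ray inside [h Y] will do. *)
Lemma escaping_ray (U : set G) : ~ countably_determined f -> countable U -> trace_closed f U ->
  exists r, [/\ is_ray r, range r `<=` ~` U, exists Y, range r `<=` ~` f Y &
    forall X, [set` X] `<=` U -> range r `<=` f X].
Proof.
move=> ncd cU clU; have [h /direction_neq[Y hY] hX] := undetermined ncd cU.
have hYf y : h Y y -> ~ f Y y by move=> hy fy; apply: hY; exact: dir_eq hy fy.
have hYU y : h Y y -> ~ U y.
  move=> hy Uy; apply: (hYf y hy); have [X XE] := trace_fset U Y.
  apply: (clU Y X) => //; rewrite -hX; last by rewrite XE => z [].
  by apply: dir_sub hy => z zX; have : [set` X] z by []; rewrite XE => -[].
have [r rr rY] := dir_ray h Y; exists r; split=> //.
- by move=> y /rY/hYU.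
- by exists Y => y /rY/hYf.
move=> X XU y /rY hy; have [w hw] := dir_ex h (X `|` Y)%fset.
have fw : f X w by rewrite -hX //; apply: dir_sub hw => z zX; rewrite inE zX.
have hw' : h Y w by apply: dir_sub hw => z zX; rewrite inE zX orbT.
apply: dir_close_in fw (dir_conn hw' hy) _ => z /hYU zU.
by apply/negP => /XU.
Qed.

(** The direction [h] of [r] agrees with [f] on [U]. If [r0] were equivalent to [r], then for a [Y]
    separating [r] from [f] a vertex of [r0] would lie in [h Y], and by closedness in [f Y]. *)
Lemma inequivalent_closed (U : set G) r r0 : trace_closed f U ->
  is_ray r -> ~ converges f r -> (forall X, [set` X] `<=` U -> range r `<=` f X) ->
  is_ray r0 -> range r0 `<=` U -> ~ ray_equiv r r0.
Proof.
move=> clU rr nfr rX rr0 r0U rr0e.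
have [Y [n nY]] := not_converges rr nfr.
pose h := ray_dir rr; have hr := ray_dir_converges rr.
have [m0 /(_ m0 (leqnn _)) hr0] := equiv_converges rr rr0 rr0e hr Y.
have [n1 /(_ (maxn n n1) (leq_maxr _ _)) hrY] := hr Y.
have [X XE] := trace_fset U Y.
have XY : {subset X <= Y} by move=> z zX; have : [set` X] z by []; rewrite XE => -[].
have hfX : h X = f X.
  apply: (dir_eq (x := r (maxn n n1))); first exact: dir_sub hrY.
  by apply: rX; [rewrite XE => z []|exists (maxn n n1)].
apply: (nY (maxn n n1)); first exact: leq_maxl.
have fr0 : f Y (r0 m0).
  apply: (clU Y X) => //; first by apply: r0U; exists m0.
  by rewrite -hfX; exact: dir_sub hr0.
by rewrite (dir_eq fr0 hr0).
Qed.

(* Let C be the component of G - U that contains an escaping ray.  If N(C) is finite, then C is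
   the component f (N(C)); otherwise N(C) converges to f, and the star-comb lemma applies. *)
Lemma new_ray (U : set G) : ~ countably_determined f -> countable U -> trace_closed f U ->
  (exists r, [/\ is_ray r, range r `<=` ~` U, dominating f (r 0%N), ~ converges f r &
    forall X, [set` X] `<=` U -> range r `<=` f X]) \/
  (exists d, [/\ is_double_ray d, range d `<=` ~` U,
    exists2 r, double_ray_tail d r & converges f r,
    exists2 r, double_ray_tail d r & ~ converges f r &
    forall X, [set` X] `<=` U -> range d `<=` f X]).
Proof.
move=> ncd cU clU; have [r [rr rU [Y rY] rX]] := escaping_ray ncd cU clU.
pose C := connected_in (~` U) (r 0%N).
have r0U : (~` U) (r 0%N) by apply: rU; exists 0%N.
have rC : range r `<=` C.
  by move=> _ [n _ <-]; apply: ray_connected => // k _; apply: rU; exists k.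
have CU : C `<=` ~` U by move=> c; exact: connected_inr.
have CX X : [set` X] `<=` U -> C `<=` f X.
  move=> XU c rc; apply: dir_close_in (rX X XU _ _) rc _; first by exists 0%N.
  by move=> z zU; apply/negP => /XU.
have C0 : C (r 0%N) by apply: rC; exists 0%N.
have Cconn c : C c -> connected_in C (r 0%N) c by exact: connected_in_self.
have nfr : ~ converges f r.
  by move=> /(_ Y)[n /(_ n (leqnn n))]; apply: rY; exists n.
pose N := [set a | U a /\ exists2 c, C c & adj c a].
(* On the trace [X] of [Y'] the set [C], and with it its neighbour [a], lies in [f X]; closedness
   passes from [X] to [Y']. *)
have Nf Y' a : N a -> a \notin Y' -> f Y' a.
  move=> [Ua [c Cc ca]] aY'; have [X XE] := trace_fset U Y'.
  apply: (clU Y' X) => //; apply: (dir_adj _ ca); first by apply: CX Cc; rewrite XE => z [].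
  by apply/negP => aX; have : [set` X] a by []; rewrite XE => -[aY _]; exact: (negP aY').
have : (exists2 v, C v & dominating f v) \/
    (exists r, [/\ is_ray r, range r `<=` C & converges f r]).
  have [/finite_fsetP[Z ZE]|infN] := pselect (finite_set N); last first.
    by apply: (star_comb C0 Cconn infN) Nf => a [].
  right; have [s rs fs] := converging_ray ncd.
  have ZU : [set` Z] `<=` U by rewrite -ZE => a [].
  (* An edge from [C] to a vertex outside [C] ends in [N], which is the deleted set [Z]. *)
  have fZC : f Z `<=` C.
    move=> y fy; have f0 := CX Z ZU _ C0.
    apply: (connected_in_ind (P := C) f0 C0 _ (dir_conn f0 fy)) => u v _ Cu uv fv.
    have Uv : ~ U v.
      move=> Uv; have /negP := dir_notin fv; apply; suff : [set` Z] v by [].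
      by rewrite -ZE; split=> //; exists u.
    by apply: (connected_in_trans Cu); apply: connected_in_adj => //; exact: CU.
  have [n sn] := fs Z; exists (fun k => s (n + k)%N); split; first exact: ray_shift.
    by move=> _ [k _ <-]; apply/fZC/sn/leq_addr.
  by apply: same_tail_converges fs; exact: same_tail_shift (same_tail_refl _).
case=> [[v Cv dv]|[a [ra aC fa]]].
  left; have [r' [rr' r'0 r'C rt]] := ray_from rr rC (Cconn v Cv).
  exists r'; split=> //; [by move=> y /r'C/CU|by rewrite r'0| |by move=> X XU y /r'C/(CX X XU)].
  by move=> /(same_tail_converges (same_tail_sym rt)).
(* Cut [a] down to a tail in [f Y]; since [r] avoids [f Y], the two rays are disjoint and can be
   joined within [C]. *)
right; have [n an] := fa Y.
pose a0 k := a (n + k)%N.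
have ra0 : is_ray a0 by exact: ray_shift.
have a0C : range a0 `<=` C by move=> _ [k _ <-]; apply: aC; exists (n + k)%N.
have a0r : range a0 `&` range r = set0.
  by apply/disjoints_subset => _ [k _ <-] /rY; apply; apply/an/leq_addr.
have Ca0 : connected_in C (a0 0%N) (r 0%N).
  by apply/connected_in_sym/Cconn/a0C; exists 0%N.
have [a' [b' [[ra' rb'] ab' adj' [a'C b'C] [at' bt']]]] :=
  double_ray_between ra0 rr a0C rC a0r Ca0.
have dC : range (join_rays a' b') `<=` C.
  by move=> _ [[k|k] _ <-]; [apply: a'C|apply: b'C]; exists k.
exists (join_rays a' b'); split.
- exact: join_rays_double.
- by move=> y /dC/CU.
- exists a'; first by exists 0%R; left => k.
  apply: same_tail_converges at' _; apply: same_tail_converges fa.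
  exact: same_tail_shift (same_tail_refl _).
- exists b'; last by move=> /(same_tail_converges (same_tail_sym bt')).
  by exists (Negz 0); right => k; have -> : (Negz 0 - k%:Z)%R = Negz k by lia.
- by move=> X XU y /dC/(CX X XU).
Qed.

Lemma ray_equiv_sym r r' : ray_equiv r r' -> ray_equiv r' r.
Proof.
move=> H [X sX]; apply: H; exists X => a b ra rb.
by rewrite connected_offE => /connected_in_sym; rewrite -connected_offE; exact: sX.
Qed.

(** Take maximal families of both kinds. If both were countable, [new_ray] applied to a closed
    countable set around them would give a ray or double ray disjoint from all members. By
    [inequivalent_closed] it could be added. *)
Lemma undetermined_families : ~ countably_determined f ->
  (exists Rs : set (nat -> G), dominating_rays f Rs) \/
  (exists Ds : set (int -> G), splitting_double_rays f Ds).
Proof.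
move=> ncd; have [r0 rr0 fr0] := converging_ray ncd.
have fE := end_ofE rr0 fr0.
have [Rs [RsP Rs2 Rsmax]] := maximal_pairwise
  [set r | is_ray r /\ dominating f (r 0%N)]
  (fun r r' => range r `&` range r' = set0 /\ ~ ray_equiv r r').
have [Ds [DsP Ds2 Dsmax]] := maximal_pairwise
  [set d | [/\ is_double_ray d, exists2 r, double_ray_tail d r & converges f r &
    exists2 r, double_ray_tail d r & ~ converges f r]]
  (fun d d' => range d `&` range d' = set0 /\ forall r r',
    double_ray_tail d r -> ~ end_of f r -> double_ray_tail d' r' -> ~ end_of f r' ->
    ~ ray_equiv r r').
have nE d r : is_double_ray d -> double_ray_tail d r -> ~ end_of f r -> ~ converges f r.
  by move=> dd dr nr fr; apply: nr; apply/fE; split=> //; exact: double_ray_tail_ray dr.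
have [cR|ncR] := pselect (countable Rs); last first.
  left; exists Rs; split=> //.
  - by move=> r /RsP[].
  - move=> r r' Rr Rr' rr'; apply: contrapT => ne.
    by have [E _] := Rs2 r r' Rr Rr' ne; move: rr'; rewrite E => -[].
  - by move=> r r' Rr Rr' ne; have [] := Rs2 r r' Rr Rr' ne.
  - by move=> r /RsP[_ dr]; apply/(dominates_endE _ rr0 fr0).
have [cD|ncD] := pselect (countable Ds); last first.
  right; exists Ds; split=> //.
  - by move=> d /DsP[].
  - move=> d d' Dd Dd' dd'; apply: contrapT => ne.
    by have [E _] := Ds2 d d' Dd Dd' ne; move: dd'; rewrite E => -[].
  - move=> d /DsP[dd [r dr fr] [r' dr' nfr']]; split.
      by exists r => //; apply/fE; split=> //; exact: double_ray_tail_ray dr.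
    by exists r' => // /fE[].
  - move=> d d' r r' Dd Dd' ne dr nr dr' nr'.
    by have [_] := Ds2 d d' Dd Dd' ne; apply.
exfalso; pose U0 := \bigcup_(r in Rs) range r `|` \bigcup_(d in Ds) range d.
have cU0 : countable U0.
  apply: countable_setU; apply: bigcup_countable => // i _; exact: countable_range.
have [g [U0g clg]] := trace_closure ncd cU0.
have RsU r : Rs r -> range r `<=` range g by move=> Rr y ry; apply: U0g; left; exists r.
have DsU d : Ds d -> range d `<=` range g by move=> Dd y dy; apply: U0g; right; exists d.
have [[r [rr rU dr nfr rX]]|[d [dd dU dr1 dr2 dX]]] := new_ray ncd (countable_range g) clg.
  have r0U : ~ range g (r 0%N) by apply: rU; exists 0%N.
  apply: r0U; apply: (RsU r); last by exists 0%N.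
  apply: Rsmax => // s Rs_s _; have [rs _] := RsP s Rs_s.
  have ine := inequivalent_closed clg rr nfr rX rs (RsU s Rs_s).
  have rs0 : range r `&` range s = set0.
    by apply/disjoints_subset => y /rU yU /(RsU s Rs_s).
  by split; split=> //; [rewrite setIC|move/ray_equiv_sym].
have d0U : ~ range g (d 0%R) by apply: dU; exists 0%R.
apply: d0U; apply: (DsU d); last by exists 0%R.
apply: Dsmax => // s Ds_s _; have [ds _ _] := DsP s Ds_s.
have ds0 : range d `&` range s = set0.
  by apply/disjoints_subset => y /dU yU /(DsU s Ds_s).
have ine t t' : double_ray_tail d t -> ~ end_of f t -> double_ray_tail s t' -> ~ ray_equiv t t'.
  move=> dt nt st'; apply: (inequivalent_closed clg).
  - exact: double_ray_tail_ray dt.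
  - exact: nE dt nt.
  - by move=> X XU y /(double_ray_tail_range dt)/(dX X XU).
  - exact: double_ray_tail_ray st'.
  - by move=> y /(double_ray_tail_range st')/(DsU s Ds_s).
split; split=> //; first by move=> t t' dt nt st' _; exact: ine st'.
  by rewrite setIC.
by move=> t t' st _ dt' nt' /ray_equiv_sym; exact: ine st.
Qed.

(** Common form of both kinds of families: [K] is the vertex set of the ray or double ray and [r] is
    a tail outside the end of [f]. The last clause records that [K] is tied to [f], by a dominating
    start or by the other tail. *)
Definition escaping (K : set G) r := [/\ is_ray r, range r `<=` K, countable K,
  ~ converges f r & forall X, K `&` [set` X] = set0 -> K `<=` f X].

(** Countably many choices use countably many vertices, so some [K o] avoids them all. The direction
    of [e o] then agrees with [f] on all these choices, although [e o] does not converge to [f]. *)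
Lemma escaping_undetermined (O : Type) (P : set O) (K : O -> set G) (e : O -> nat -> G) :
  ~ countable P -> trivIset P K -> (forall o, P o -> escaping (K o) (e o)) ->
  ~ countably_determined f.
Proof.
move=> ncP tP Pe [S [cS _ Sd]].
have cU : countable (\bigcup_(c in S) [set` c.1]).
  by apply: bigcup_countable => // c _; apply/finite_set_countable/finite_fset.
have [o Po oU] := uncountable_avoid tP ncP cU.
have [rr rK _ nfr KX] := Pe o Po.
have [|c Sc [fc hc]] := Sd (ray_dir rr).
  by move=> E; apply: nfr; rewrite -E; exact: ray_dir_converges.
have [n /(_ n (leqnn n)) hn] := ray_dir_converges rr c.1.
apply: hc; rewrite -fc; apply: (dir_eq hn); apply: KX; last by apply: rK; exists n.
by apply/disjoints_subset => y Ky yc; have : (K o `&` \bigcup_(c in S) [set` c.1]) y;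
  [split=> //; exists c|rewrite oU].
Qed.

End Undetermined.

(** * Star-decompositions *)

Section Stars.
Variables (G : sgraph) (I : choiceType).
Implicit Types (X Y Z : {fset G}) (x y z v : G) (r : nat -> G).

Lemma star_is_tree : is_tree (star I).
Proof.
split; first by exists None.
  move=> [i|] [j|].
  - by exists [:: None; Some j].
  - by exists [:: None].
  - by exists [:: Some j].
  - by exists [::].
(* Centre and leaves alternate along a cycle: length 3 violates parity, and among four consecutive
   vertices the centre occurs twice. *)
move=> [|x [|y [|z [|w c]]]] //=.
  by move: x y z => [i|] [j|] [k|].
  by move: x y z w => [i|] [j|] [k|] [l|] //=; rewrite /ucycle /= ?inE ?andbF.
Qed.

Variables (S : set I) (C : I -> set G) (X : I -> {fset G}).

(* The leaves outside S carry empty parts. *)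
Definition star_part (t : star I) : set G :=
  if t is Some i then [set x | S i /\ (C i x \/ x \in X i)]
  else [set x | forall i, S i -> ~ C i x].

Hypothesis CX : forall i x y, S i -> C i x -> adj x y -> C i y \/ y \in X i.
Hypothesis XC : forall i j x, S i -> S j -> C i x -> x \notin X j.
Hypothesis C_triv : trivIset S C.

(** Edges at [C i] stay in leaf part [i] by [CX], and distinct leaf parts meet only in the central
    part by [XC] and [C_triv]. Paths in a star have at most three vertices. *)
Lemma star_part_decomposition : tree_decomposition star_part.
Proof.
split; first exact: star_is_tree.
- move=> x; have [[i [Si Ci]]|H] := pselect (exists i, S i /\ C i x).
    by exists (Some i); split=> //; left.
  by exists None => i Si Ci; apply: H; exists i.
- have H x y i : adj x y -> S i -> C i x -> exists t, star_part t x /\ star_part t y.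
    by move=> xy Si Ci; exists (Some i); split; split=> //; [left|exact: CX xy].
  move=> x y xy; have [[i [Si Ci]]|nx] := pselect (exists i, S i /\ C i x); first exact: H Ci.
  have [[i [Si Ci]]|ny] := pselect (exists i, S i /\ C i y).
    by have [|t [ty tx]] := H y x i _ Si Ci; [rewrite adj_sym|exists t].
  by exists None; split=> i Si Ci; [apply: nx|apply: ny]; exists i.
- have H i j : i <> j -> star_part (Some i) `&` star_part (Some j) `<=` star_part None.
    have sub k l : k <> l -> forall x, star_part (Some k) x -> S l -> ~ C l x.
      move=> kl x [Sk [Ck|xX]] Sl Cl; last by have := XC Sl Sk Cl; rewrite xX.
      by apply: kl; apply: C_triv => //; exists x.
    move=> ij x [ix jx] k Sk; have [ki|ki] := pselect (i = k); last exact: sub ix Sk.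
    by apply: sub jx Sk => jk; apply: ij; rewrite ki.
  move=> t1 [|a [|b [|c s]]] /=.
  + by move=> _ _ t2; rewrite inE => /eqP-> x [].
  + by move=> _ _ t2; rewrite !inE => /orP[]/eqP-> x [].
  + move=> /and3P[t1a ab _] /and3P[]; rewrite !inE negb_or => /andP[_ t1b] _ _ t2.
    rewrite !inE => /or3P[]/eqP-> x [] // Vt Vb.
    move: a b t1 t1a ab t1b Vt Vb => [j|] [k|] [i|] // _ _ ik Vi Vk.
    by apply: (H i k) => // ik'; move: ik; rewrite ik' eqxx.
  + by move: t1 a b c => [i|] [j|] [k|] [l|] //= _; rewrite !inE /= ?andbF.
Qed.

Lemma star_part_adhesion : finite_adhesion star_part.
Proof.
move=> [i|] [j|] // _.
  apply: sub_finite_set (finite_fset (X i)) => x [[Si [Ci|//]] H].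
  by case: (H i Si Ci).
apply: sub_finite_set (finite_fset (X j)) => x [H [Sj [Cj|//]]].
by case: (H j Sj Cj).
Qed.

(** Otherwise a tail of [r] runs inside the union of the sets [C i]. It cannot change from one to
    another, as leaving [C i] leads into [X i], which meets no [C j]. *)
Lemma star_part_ray r : is_ray r ->
  (forall i, S i -> ~ exists n, forall m, (n <= m)%N -> C i (r m)) ->
  infinite_set (range r `&` star_part None).
Proof.
move=> [ri ra] nC fin; have rr : is_ray r by split.
have /finite_fsetP[Y YE] := fin.
have [n nY] := ray_leave Y rr.
have inC m : (n <= m)%N -> exists i, S i /\ C i (r m).
  move=> /nY/negP mY; apply: contrapT => H; apply: mY; suff : [set` Y] (r m) by [].
  by rewrite -YE; split; [exists m|move=> i Si Ci; apply: H; exists i].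
have [i [Si Ci]] := inC n (leqnn n).
apply: (nC i Si); exists n => m /subnK <-; elim: (m - n)%N => [//|k IH].
have [j [Sj Cj]] := inC (k.+1 + n)%N (leq_addl _ _).
have [//|] := CX Si IH (ra _).
by rewrite -addSn (negbTE (XC Sj Si Cj)).
Qed.

End Stars.

(** * Selecting the leaf parts, and the theorem *)

Section Refinement.
Variables (G : sgraph) (f : direction G).
Implicit Types (X Y Z : {fset G}) (x y z v : G) (r : nat -> G).

(** Choose a maximal family of pairs of an index and a finite set separating its ray from [f], such
    that the components holding the ray tails are disjoint and avoid all the finite sets. If the
    family is uncountable, these components give the leaf parts. If it is countable, an index whose
    [K] avoids a closed set around the family supplies a further pair. *)
Lemma escaping_star (O : choiceType) (P : set O) (K : O -> set G) (e : O -> nat -> G) :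
  ~ countable P -> trivIset P K -> (forall o, P o -> escaping f (K o) (e o)) ->
  exists (S : set O) (V : star O -> set G),
    [/\ S `<=` P, ~ countable S /\ uncountable_star_decomposition V, finite_adhesion V,
    forall r, is_ray r -> converges f r -> infinite_set (range r `&` V None) &
    forall o, S o -> exists n, forall m, (n <= m)%N -> V (Some o) (e o m)].
Proof.
move=> ncP tP Pe; have ncd := escaping_undetermined ncP tP Pe.
pose comp (s : O * {fset G}) := ray_comp (e s.1) s.2.
have [S [SP S2 Smax]] := maximal_pairwise
  [set s : O * {fset G} | P s.1 /\ exists n, forall m, (n <= m)%N -> ~ f s.2 (e s.1 m)]
  (fun s t => [/\ comp s `&` comp t = set0, comp s `&` [set` t.2] = set0 &
    comp t `&` [set` s.2] = set0]).
have rays o : P o -> is_ray (e o) by move=> /Pe[].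
have compX s : comp s `&` [set` s.2] = set0.
  apply/disjoints_subset => y [n /(_ n (leqnn n))]; rewrite connected_offE.
  exact: connected_inl.
have comp_adj s x y : comp s x -> adj x y -> comp s y \/ y \in s.2.
  move=> [n nP] xy; have [?|/negP ys] := boolP (y \in s.2); [by right|left].
  exists n => m /nP; rewrite !connected_offE => xm; apply: (connected_in_trans _ xm).
  by apply: connected_in_adj => //; [rewrite adj_sym|exact: connected_inl xm].
have compf s : S s -> comp s `<=` ~` f s.2.
  move=> /SP[Ps [n nf]] y [k kP] fy; apply: (nf (maxn n k)); first exact: leq_maxl.
  by apply: dir_close fy (kP _ (leq_maxr _ _)).
have [n_ n_P] : exists n_ : O * {fset G} -> nat,
    forall s, P s.1 -> forall m, (n_ s <= m)%N -> comp s (e s.1 m).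
  have /choice[n_ n_P] s : exists n, P s.1 -> forall m, (n <= m)%N -> comp s (e s.1 m).
    have [Ps|] := pselect (P s.1); last by exists 0%N.
    by have [n] := ray_comp_tail s.2 (rays _ Ps); exists n.
  by exists n_.
have comp_triv s t x : S s -> S t -> comp s x -> comp t x -> s = t.
  move=> Ss St sx tx; apply: contrapT => /(S2 s t Ss St)[E _ _].
  by have : (comp s `&` comp t) x by []; rewrite E.
have compXY s t x : S s -> S t -> comp s x -> x \notin t.2.
  move=> Ss St sx; apply/negP => xt; have [E|/(S2 s t Ss St)[_ E _]] := pselect (s = t).
    have : (comp t `&` [set` t.2]) x by split=> //=; rewrite -E.
    by rewrite compX.
  by have : (comp s `&` [set` t.2]) x by []; rewrite E.
have [cS|ncS] := pselect (countable S); last first.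
  pose S' := [set s.1 | s in S].
  have /choice[X_ X_P] o : exists X, S' o -> S (o, X).
    have [[[o' X] SoX /= <-]|] := pselect (S' o); first by exists X.
    by exists fset0.
  pose C_ o := comp (o, X_ o).
  have S'C o : S' o -> S (o, X_ o) by exact: X_P.
  (* No index occurs twice: two pairs with the same ray have intersecting components, so they are
     equal. *)
  have ncS' : ~ countable S'.
    move=> cS'; apply: ncS; apply: sub_countable _ cS'.
    rewrite -(card_le_eql (inj_card_eq (f := fst) _)) //.
    move=> s t /set_mem Ss /set_mem St st; have Ps := (SP s Ss).1.
    apply: (comp_triv s t (e s.1 (maxn (n_ s) (n_ t)))) => //.
      by apply: n_P => //; exact: leq_maxl.
    by rewrite st; apply: n_P; [rewrite -st|exact: leq_maxr].
  have S'P : S' `<=` P by move=> _ [s /SP[Ps _] <-].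
  have CX o x y : S' o -> C_ o x -> adj x y -> C_ o y \/ y \in X_ o.
    by move=> _; exact: comp_adj.
  have XC i j x : S' i -> S' j -> C_ i x -> x \notin X_ j.
    by move=> /S'C Si /S'C Sj; exact: compXY Si Sj.
  have C_triv : trivIset S' C_.
    by move=> i j /S'C Si /S'C Sj [x [ix jx]]; have [] := comp_triv _ _ x Si Sj ix jx.
  exists S', (star_part S' C_ X_); split=> //.
  - split=> //; split; last exact: star_part_decomposition.
    by move=> cT; apply: ncS'; apply: sub_countable cT; exact: subset_card_le.
  - exact: star_part_adhesion.
  - move=> r rr fr; apply: (star_part_ray CX XC rr) => o So [n nP].
    have [m mP] := fr (X_ o); apply: (compf _ (S'C o So) (r (maxn n m))).
      exact/nP/leq_maxl.
    exact/mP/leq_maxr.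
  - move=> o So; exists (n_ (o, X_ o)) => m nm; split=> //; left.
    by apply: n_P => //; exact: S'P.
exfalso; pose U0 := \bigcup_(s in S) (K s.1 `|` [set` s.2]).
have cU0 : countable U0.
  apply: bigcup_countable => // s /SP[Ps _]; apply: countable_setU.
    by have [] := Pe _ Ps.
  exact/finite_set_countable/finite_fset.
have [g [U0g clg]] := trace_closure ncd cU0.
have [o Po oU] := uncountable_avoid tP ncP (countable_range g).
have oU' y : K o y -> ~ range g y.
  by move=> oy gy; have : (K o `&` range g) y by []; rewrite oU.
have [rr rK _ nfr KX] := Pe o Po.
have KfX X : [set` X] `<=` range g -> K o `<=` f X.
  by move=> XU; apply: KX; apply/disjoints_subset => y /oU' yU /XU.
have Sg s : S s -> [set` s.2] `<=` range g.
  by move=> Ss y ys; apply: U0g; exists s => //; right.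
have rf n s : S s -> f s.2 (e o n).
  by move=> Ss; apply: (KfX _ (Sg s Ss)); apply: rK; exists n.
have [Y [n nY]] := not_converges rr nfr.
have tS : trivIset S comp.
  by move=> s t Ss St [x [sx tx]]; exact: comp_triv sx tx.
pose J := [set s | S s /\ comp s `&` [set` Y] !=set0].
have finJ : finite_set J by apply: finite_hit tS (finite_fset Y).
have /finite_fsetP[Y' Y'E] : finite_set
    (* Vertices of [Y] inside components of the family are replaced by the separators of these
       components. Only finitely many components meet [Y], so the result is finite. *)
    (([set` Y] `\` \bigcup_(s in S) comp s) `|` \bigcup_(s in J) [set` s.2]).
  rewrite finite_setU; split; first exact/finite_setD/finite_fset.
  by apply: bigcup_finite => // s _; exact: finite_fset.
have inY' y : y \in Y' <->
    ([set` Y] y /\ ~ exists2 s, S s & comp s y) \/ exists2 s, J s & y \in s.2.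
  split=> [yY'|H]; last by suff : [set` Y'] y by []; rewrite -Y'E.
  by have : [set` Y'] y by []; rewrite -Y'E.
have JY' s y : J s -> y \in s.2 -> y \in Y' by move=> Js ys; apply/inY'; right; exists s.
(* Moving the separator out of the components it meets, onto their boundaries,
   keeps it separating: the ray and the direction lie outside these components. *)
have nY' m : (n <= m)%N -> ~ f Y' (e o m).
  move=> nm fm; apply: (nY m nm); have [w fw] := dir_ex f (Y `|` Y')%fset.
  have fw' : f Y' w by apply: dir_sub fw => z zY; rewrite inE zY orbT.
  have fwY : f Y w by apply: dir_sub fw => z zY; rewrite inE zY.
  apply: dir_close_in fwY (dir_conn fw' fm) _ => z fz; apply/negP => zY.
  have /negP := dir_notin fz; apply; apply/inY'; left; split=> // -[s Ss sz].
  have Js : J s by split=> //; exists z.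
  by apply: (compf s Ss z sz); apply: dir_sub fz => y; exact: JY'.
pose s0 := (o, Y').
have s0f m y : (n <= m)%N -> comp s0 y -> ~ f Y' y.
  move=> nm [k kP] fy; apply: (nY' (maxn n k) (leq_maxl _ _)).
  exact: dir_close fy (kP _ (leq_maxr _ _)).
(* On the trace of [Y'] the ray [e o] lies with [f], and so does [y]; if [y] were in the closed set,
   it would lie in [f Y'] as well. *)
have s0U y : comp s0 y -> ~ range g y.
  move=> sy gy; apply: (s0f n y (leqnn n) sy); have [X XE] := trace_fset (range g) Y'.
  apply: (clg Y' X) => //; have [k /(_ k (leqnn k)) yk] := sy.
  have fk : f X (e o k) by apply: (KfX X); [rewrite XE => z []|apply: rK; exists k].
  move: yk; rewrite connected_offE => /connected_in_sym yk.
  apply: dir_close_in fk yk _ => z zY'; apply/negP => zX; apply: zY'.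
  by have : [set` X] z by []; rewrite XE => -[].
have Ss0 : S s0.
  apply: Smax; first by split=> //=; exists n.
  move=> s Ss _.
  have cs0 : comp s0 `&` [set` s.2] = set0.
    by apply/disjoints_subset => y /s0U yU /(Sg s Ss).
  have scs : comp s `&` [set` s0.2] = set0.
    apply/disjoints_subset => y sy /inY'[[_ []]|[t [St _] yt]]; first by exists s.
    by have /negP := compXY s t y Ss St sy.
  (* The component of [s0] avoids the closed set, hence also [s.2]. A common vertex would be linked
     to [e o] within it and so lie in [f s.2]. *)
  have ss0 : comp s0 `&` comp s = set0.
    apply/disjoints_subset => y s0y sy; have [k /(_ k (leqnn k)) yk] := s0y.
    have sub z : connected_in (~` [set` Y']) y z -> comp s0 z.
      move=> yz; have [l lP] := s0y; exists l => m /lP; rewrite !connected_offE.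
      exact: connected_in_trans (connected_in_sym yz).
    move: yk; rewrite connected_offE => /connected_in_self/(connected_in_sub sub) yk.
    apply: (compf s Ss y sy); apply: dir_close_in (rf k s Ss) (connected_in_sym yk) _.
    by move=> z /s0U zU; apply/negP => /(Sg s Ss).
  by split; split=> //; rewrite setIC.
(* As [s0] belongs to the family, [K o] lies in the closed set that it was chosen to avoid. *)
apply: (oU' (e o 0%N)); first by apply: rK; exists 0%N.
by apply: U0g; exists s0 => //; left; apply: rK; exists 0%N.
Qed.

End Refinement.

(** At most one of the pairwise inequivalent rays converges to [f], and it is dropped. Any other ray
    that avoids [X] is in [f X] from its dominating start on. *)
Lemma dominating_rays_escape (G : sgraph) (f : direction G) (Rs : set (nat -> G)) :
  dominating_rays f Rs -> exists Ps : set (nat -> G), [/\ Ps `<=` Rs, ~ countable Ps,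
    trivIset Ps (fun r => range r) & forall r, Ps r -> escaping f (range r) r].
Proof.
move=> [ncR Rray tR Rne Rdom]; pose Ps := [set r | Rs r /\ ~ converges f r].
exists Ps; split.
- by move=> r [].
- move=> cP; apply: ncR.
  have -> : Rs = Ps `|` [set r | Rs r /\ converges f r].
    by apply/seteqP; split=> r; [have [?|?] := pselect (converges f r); [right|left]|case=> -[]].
  apply: countable_setU => //; apply: finite_set_countable.
  have [[r0 [Rr0 fr0]]|H] := pselect (exists r, Rs r /\ converges f r).
    apply: sub_finite_set (finite_set1 r0) => r [Rr fr] /=; apply: contrapT => ne.
    by apply: (Rne r r0 Rr Rr0 ne); exact: converges_equiv fr fr0.
  by apply: sub_finite_set (finite_set0 _) => r Rr; apply: H; exists r.
- by move=> r r' [Rr _] [Rr' _]; exact: tR.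
- move=> r [Rr nfr]; have rr := Rray r Rr; split=> //; first exact: countable_range.
  move=> X rX; have rX' n : r n \notin X.
    by apply/negP => nX; have : (range r `&` [set` X]) (r n) by [split=> //; exists n]; rewrite rX.
  have [r0 fr0 d0] := Rdom r Rr.
  have dr : dominating f (r 0%N).
    apply: dominates_dominating d0; first exact: end_of_is_ray fr0.
    exact: end_of_converges fr0.
  move=> _ [n _ <-]; apply: (ray_tail_dir rr (n := 0%N) _ _ _ (dr X (rX' _))) => //.
Qed.

(** A double ray avoiding [X] is connected in [G - X] and has a tail that is eventually in [f X], so
    it lies entirely in [f X]. *)
Lemma splitting_double_rays_escape (G : sgraph) (f : direction G) (Ds : set (int -> G)) :
  splitting_double_rays f Ds -> exists e : (int -> G) -> nat -> G,
    forall d, Ds d -> double_ray_tail d (e d) /\ escaping f (range d) (e d).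
Proof.
move=> [_ Dray _ Dtails _].
have /choice[e eP] d : exists r, Ds d -> double_ray_tail d r /\ ~ end_of f r.
  have [/Dtails[_ [r dr nr]]|] := pselect (Ds d); first by exists r.
  by exists (fun _ => d 0%R).
exists e => d Dd; have [de ne] := eP d Dd; split=> //.
have dd := Dray d Dd; have [[r dr fr] _] := Dtails d Dd.
have re := double_ray_tail_ray dd de.
split=> //; [exact: double_ray_tail_range|exact: countable_range| |].
  by move=> fe; apply: ne; apply/(end_ofP fr).
move=> X dX; have dX' z : range d z -> z \notin X.
  by move=> dz; apply/negP => zX; have : (range d `&` [set` X]) z by []; rewrite dX.
have [n /(_ n (leqnn n)) fn] := end_of_converges fr X.
have [k _ kn] : range d (r n) by apply: (double_ray_tail_range dr); exists n.
move=> _ [l _ <-]; apply: dir_close_in fn _ dX'; rewrite -kn.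
have := double_ray_connected dd l.
exact: connected_in_trans (connected_in_sym (double_ray_connected dd k)).
Qed.

Theorem theorem2 (G : sgraph) (f : direction G) :
  [/\ ~ countably_determined f <->
        (exists Rs : set (nat -> G), dominating_rays f Rs) \/
        (exists Ds : set (int -> G), splitting_double_rays f Ds),
      (exists Rs : set (nat -> G), dominating_rays f Rs) ->
        exists (Rs : set (nat -> G)) (I : choiceType) (V : star I -> set G)
               (leaf : (nat -> G) -> I),
          dominating_rays f Rs /\
          [/\ uncountable_star_decomposition V,
              finite_adhesion V,
              lives_in f (V None),
              set_inj Rs leaf &
              forall r, Rs r -> ray_has_tail_in r (V (Some (leaf r)))] &
      (exists Ds : set (int -> G), splitting_double_rays f Ds) ->
        exists (Ds : set (int -> G)) (I : choiceType) (V : star I -> set G)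
               (leaf : (int -> G) -> I),
          splitting_double_rays f Ds /\
          [/\ uncountable_star_decomposition V,
              finite_adhesion V,
              lives_in f (V None),
              set_inj Ds leaf &
              forall d, Ds d -> double_ray_has_tail_in d (V (Some (leaf d)))]].
Proof.
split.
- split; first exact: undetermined_families.
  case=> [[Rs /dominating_rays_escape[Ps [_ ncP tP Pe]]]|[Ds H]].
    exact: escaping_undetermined ncP tP Pe.
  have [e eP] := splitting_double_rays_escape H; have [ncD _ tD _ _] := H.
  by apply: escaping_undetermined ncD tD _ => d /eP[_]; apply.
- move=> [Rs H]; have [Ps [PR ncP tP Pe]] := dominating_rays_escape H.
  have [S [V [SP [ncS Vstar] Vfin Vend Vtail]]] := escaping_star ncP tP Pe.
  have [_ Rray tR Rne Rdom] := H.
  have SR : S `<=` Rs by move=> r /SP/PR.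
  (* A member of the uncountable [S] is needed to obtain a ray of the end of [f], the witness for
     [lives_in]. *)
  have [r1 S1] := infinite_setN0 (contra_not (@finite_set_countable _ _) ncS).
  have [r0 fr0 _] := Rdom _ (SR _ S1).
  (* The leaves are indexed by all maps, so each ray of [S] is the index of its own leaf. *)
  exists S, (nat -> G), V, id; split; first split=> //.
  + by move=> r /SR/Rray.
  + by move=> r r' /SR Rr /SR Rr'; exact: tR.
  + by move=> r r' /SR Rr /SR Rr'; exact: Rne.
  + by move=> r /SR/Rdom.
  + split=> //; first (exists r0 => //; apply: Vend).
    * exact: end_of_is_ray fr0.
    * exact: end_of_converges fr0.
- move=> [Ds H]; have [e eP] := splitting_double_rays_escape H.
  have [ncD Dray tD Dtails Dne] := H.
  have [S [V [SD [ncS Vstar] Vfin Vend Vtail]]] :=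
    escaping_star ncD tD (fun d Dd => (eP d Dd).2).
  have [d1 S1] := infinite_setN0 (contra_not (@finite_set_countable _ _) ncS).
  have [[r0 _ fr0] _] := Dtails _ (SD _ S1).
  exists S, (int -> G), V, id; split; first split=> //.
  + by move=> d /SD/Dray.
  + by move=> d d' /SD Dd /SD Dd'; exact: tD.
  + by move=> d /SD/Dtails.
  + by move=> d d' r r' /SD Dd /SD Dd'; exact: Dne.
  + split=> //; first (exists r0 => //; apply: Vend).
    * exact: end_of_is_ray fr0.
    * exact: end_of_converges fr0.
    move=> d Sd; have [n nP] := Vtail d Sd; have [de _] := eP d (SD d Sd).
    exists (fun k => e d (n + k)%N); first exact: double_ray_tail_shift.
    by move=> _ [k _ <-]; apply/nP/leq_addr.
Qed.
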